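(* Let $\Gamma_{k+1}$, $k\ge 0$, be connected simple graphs, $\Gamma_{k+1}$ having $k+1$ vertices, and let $P_k=P_{\Gamma_{k+1}}$ be the corresponding graph-associahedra. If the subring of $\mathfrak S$ generated by the $P_k$, $k\ge 0$, is closed under the derivation $d$, then either $P_k$ is the associahedron $\mathfrak a_{k+1}$ for all $k$, or $P_k$ is the permutohedron $\pi_{k+1}$ for all $k$.
   Context: $\mathfrak P$ is the free abelian group generated by combinatorial equivalence classes of convex polytopes, graded by dimension, made into a commutative ring by the Cartesian product (the point is the unit); $\mathfrak S\subset\mathfrak P$ is the subring spanned by simple polytopes. The derivation $d:\mathfrak P\to\mathfrak P$ is defined by $dP=$ sum of all facets of $P$ (extended additively); it satisfies the Leibniz rule and preserves $\mathfrak S$. For a connected simple graph $\Gamma$ with vertex set $[n]$, let $\mathcal B(\Gamma)$ be the set of nonempty $S\subseteq[n]$ with $\Gamma|_S$ connected; the graph-associahedron is $P_\Gamma=\{x\in\mathbb R^n:\sum_{i=1}^n x_i=3^n,\ \sum_{i\in S}x_i\ge 3^{|S|}\ \forall S\in\mathcal B(\Gamma), S\ne[n]\}$, an $(n-1)$-dimensional simple polytope. The associahedron $\mathfrak a_n$ is $P_\Gamma$ for $\Gamma$ the path with $n$ vertices; the permutohedron $\pi_n$ is $P_\Gamma$ for $\Gamma$ the complete graph with $n$ vertices. *)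

(* Defs.v *)
From HB Require Import structures.
From mathcomp Require Import all_boot all_order all_algebra generic_quotient.
From mathcomp Require Import boolp classical_sets functions cardinality fsbigop.
From mathcomp Require Import reals topology normedtype.
(* The notations of [monalg] clash with those of the analysis library, so
   [malg K int] is written for [{malg int[K]}], the free abelian group on [K],
   and [mkmalgU k 1] for the generator [<< k >>]. *)
From mathcomp Require Import -(notations) monalg.

Set Implicit Arguments.
Unset Strict Implicit.
Unset Printing Implicit Defensive.

Import Order.TTheory GRing.Theory Num.Theory.
Local Open Scope classical_set_scope.
Local Open Scope quotient_scope.
Local Open Scope ring_scope.

Section Polytopes.
Variable R : realType.

Definition dotp n (a x : 'rV[R]_n) : R := \sum_i a 0 i * x 0 i.

(* By Minkowski-Weyl these are exactly the convex hulls of nonempty finite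
   sets. *)
Definition is_polytope n (P : set 'rV[R]_n) : Prop :=
  [/\ P !=set0, bounded_set P &
      exists (I : finType) (a : I -> 'rV[R]_n) (b : I -> R),
        P = [set x | forall i, dotp (a i) x <= b i]].

Record polytope n := Polytope {
  polytope_set :> set 'rV[R]_n;
  polytopeP : is_polytope polytope_set }.

HB.instance Definition _ n := gen_eqMixin (polytope n).
HB.instance Definition _ n := gen_choiceMixin (polytope n).

(* Both the empty set and [P] itself count as faces. *)
Definition faces n (P : set 'rV[R]_n) : set (set 'rV[R]_n) :=
  [set F | exists (a : 'rV[R]_n) (c : R),
     P `<=` [set x | dotp a x <= c] /\ F = P `&` [set x | dotp a x = c]].

(* Members of [polytope n] are nonempty, so the empty face does not count and a
   point has no facets; [nface_polytope] shows that no facet is lost by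
   restricting to members of [polytope n]. *)
Definition facets n (P : set 'rV[R]_n) : set (polytope n) :=
  [set F : polytope n | [/\ faces P F, F <> P :> set _ &
     forall G, faces P G -> F `<=` G -> G = F \/ G = P]].

Definition comb_equiv n m (P : set 'rV[R]_n) (Q : set 'rV[R]_m) : Prop :=
  exists f : set 'rV[R]_n -> set 'rV[R]_m,
    set_bij (faces P) (faces Q) f /\
    forall F G, faces P F -> faces P G -> (F `<=` G <-> f F `<=` f G).

Definition prod_set n m (P : set 'rV[R]_n) (Q : set 'rV[R]_m) :
    set 'rV[R]_(n + m) :=
  [set x | P (lsubmx x) /\ Q (rsubmx x)].

Definition nfaces n (P : set 'rV[R]_n) : set (set 'rV[R]_n) :=
  [set F | faces P F /\ F !=set0].

(* Isomorphism of the posets of nonempty faces, used to prove that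
   combinatorial equivalence is compatible with products and facets. *)
Definition comb_ne n m (P : set 'rV[R]_n) (Q : set 'rV[R]_m) : Prop :=
  exists (f : set 'rV[R]_n -> set 'rV[R]_m) (g : set 'rV[R]_m -> set 'rV[R]_n),
  [/\ forall F, nfaces P F -> nfaces Q (f F) /\ g (f F) = F,
      forall G, nfaces Q G -> nfaces P (g G) /\ f (g G) = G,
      forall F F', nfaces P F -> nfaces P F' -> F `<=` F' -> f F `<=` f F' &
      forall G G', nfaces Q G -> nfaces Q G' -> G `<=` G' -> g G `<=` g G'].

Lemma dotp0 n (x : 'rV[R]_n) : dotp 0 x = 0.
Proof. by rewrite /dotp big1 // => i _; rewrite mxE mul0r. Qed.

Lemma faces0 n (P : set 'rV[R]_n) : faces P set0.
Proof.
exists 0, 1; split=> [x _ /=|]; first by rewrite dotp0 ler01.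
apply/seteqP; split=> x //= [_]; rewrite dotp0 => /eqP.
by rewrite eq_sym oner_eq0.
Qed.

Lemma faces_self n (P : set 'rV[R]_n) : faces P P.
Proof.
exists 0, 0; split=> [x _ /=|]; first by rewrite dotp0.
by apply/seteqP; split=> x //= => [Px|[]//]; rewrite dotp0.
Qed.

Lemma faces_sub n (P F : set 'rV[R]_n) : faces P F -> F `<=` P.
Proof. by move=> [a [c [_ ->]]] x []. Qed.

Lemma ne_set0 T (A : set T) : A !=set0 -> A <> set0.
Proof. by move=> [x Ax] A0; rewrite A0 in Ax. Qed.

Lemma comb_equivP n m (P : set 'rV[R]_n) (Q : set 'rV[R]_m) :
  comb_equiv P Q <-> comb_ne P Q.
Proof.
split.
- move=> [f [[ff fi fs] fm]].
  have finj F G : faces P F -> faces P G -> f F = f G -> F = G.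
    by move=> PF PG; apply: fi; rewrite inE.
  have f0 : f set0 = set0.
    have [F PF fF] := fs _ (faces0 Q).
    apply/seteqP; split=> // x.
    have /(fm _ _ (faces0 P) PF) : set0 `<=` F by [].
    by rewrite fF; apply.
  have fN F : faces P F -> (f F !=set0 <-> F !=set0).
    move=> PF; split=> /ne_set0 H; apply/set0P/eqP => E; apply: H.
      by rewrite E f0.
    by apply: finj => //; [exact: faces0|rewrite f0].
  have /choice[g gP] (G : set 'rV[R]_m) :
      exists F, faces Q G -> faces P F /\ f F = G.
    have [QG|nQG] := pselect (faces Q G); last by exists set0.
    by have [F PF <-] := fs _ QG; exists F.
  have gN G : nfaces Q G -> nfaces P (g G) /\ f (g G) = G.
    move=> [QG G0]; have [Pg fg] := gP _ QG; split=> //; split=> //.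
    by apply/(fN _ Pg); rewrite fg.
  exists f, g; split.
  + move=> F [PF F0]; have Qf := ff _ PF; split; first by split=> //; apply/fN.
    by have [Pg fg] := gP _ Qf; apply: finj.
  + exact: gN.
  + by move=> F F' [PF _] [PF' _]; move/(fm _ _ PF PF').
  + move=> G G' /gN[[Pg _] fg] /gN[[Pg' _] fg'] GG'.
    by apply/(fm _ _ Pg Pg'); rewrite fg fg'.
- move=> [f [g [fP gP fm gm]]].
  pose h F := if F == set0 then set0 else f F.
  have h0 : h set0 = set0 by rewrite /h eqxx.
  have hN F : F !=set0 -> h F = f F.
    by move=> /ne_set0/eqP/negbTE; rewrite /h => ->.
  have cases (k : nat) (F : set 'rV[R]_k) : F = set0 \/ F !=set0.
    by have [->|/set0P] := eqVneq F set0; [left|right].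
  exists h; split; first split.
  + move=> F PF; have [->|F0] := cases _ F; first by rewrite h0; exact: faces0.
    by rewrite hN //; have [[]] := fP F (conj PF F0).
  + move=> F G; rewrite !inE => PF PG.
    have [->|F0] := cases _ F; have [->|G0] := cases _ G => //.
    * rewrite h0 hN // => E; have [[_ /ne_set0]] := fP G (conj PG G0).
      by rewrite -E.
    * rewrite h0 hN // => E; have [[_ /ne_set0]] := fP F (conj PF F0).
      by rewrite E.
    * rewrite !hN // => E; have [_ <-] := fP F (conj PF F0).
      by have [_ <-] := fP G (conj PG G0); rewrite E.
  + move=> G QG; have [->|G0] := cases _ G.
      by exists set0; [exact: faces0|].
    have [[Pg g0] fg] := gP G (conj QG G0).
    by exists (g G) => //; rewrite hN.
  + move=> F G PF PG.
    have [->|F0] := cases _ F; first by rewrite h0; split=> _; exact: sub0set.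
    have [->|G0] := cases _ G.
      rewrite h0 (hN F) //; have [[_ [y fy]] _] := fP F (conj PF F0).
      by have [x Fx] := F0; split=> [/(_ x Fx)//|/(_ y fy)].
    rewrite !hN //; split; first exact: fm.
    have [nf gf] := fP F (conj PF F0); have [nf' gf'] := fP G (conj PG G0).
    by move=> /(gm _ _ nf nf'); rewrite gf gf'.
Qed.

Lemma comb_ne_refl n (P : set 'rV[R]_n) : comb_ne P P.
Proof. by exists id, id; split. Qed.

Lemma comb_ne_sym n m (P : set 'rV[R]_n) (Q : set 'rV[R]_m) :
  comb_ne P Q -> comb_ne Q P.
Proof. by move=> [f [g [fP gP fm gm]]]; exists g, f; split. Qed.

Lemma comb_ne_trans n m k (P : set 'rV[R]_n) (Q : set 'rV[R]_m)
    (T : set 'rV[R]_k) : comb_ne P Q -> comb_ne Q T -> comb_ne P T.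
Proof.
move=> [f [g [fP gP fm gm]]] [f' [g' [fP' gP' fm' gm']]].
exists (f' \o f), (g \o g'); split=> [F|G|F F'|G G'] /=.
- move=> /fP[/[dup] Qf /fP'[Tf gf'] gf]; split=> //.
  by rewrite gf'.
- move=> /gP'[/[dup] Qg /gP[Tg gg'] gg]; split=> //.
  by rewrite gg'.
- by move=> PF PF' FF'; apply: fm'; [case: (fP F)|case: (fP F')|exact: fm].
- by move=> PF PF' FF'; apply: gm; [case: (gP' G)|case: (gP' G')|exact: gm'].
Qed.

Lemma dotp_row n m (a : 'rV[R]_(n + m)) (x : 'rV[R]_n) (y : 'rV[R]_m) :
  dotp a (row_mx x y) = dotp (lsubmx a) x + dotp (rsubmx a) y.
Proof.
rewrite /dotp big_split_ord /=; congr (_ + _); apply: eq_bigr => i _.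
  by rewrite row_mxEl mxE.
by rewrite row_mxEr mxE.
Qed.

Lemma dotp_split n m (a x : 'rV[R]_(n + m)) :
  dotp a x = dotp (lsubmx a) (lsubmx x) + dotp (rsubmx a) (rsubmx x).
Proof. by rewrite -{1}(hsubmxK x) dotp_row. Qed.

Definition lset n m (A : set 'rV[R]_(n + m)) : set 'rV[R]_n := lsubmx @` A.
Definition rset n m (A : set 'rV[R]_(n + m)) : set 'rV[R]_m := rsubmx @` A.

Lemma lset_prod n m (A : set 'rV[R]_n) (B : set 'rV[R]_m) :
  B !=set0 -> lset (prod_set A B) = A.
Proof.
move=> [y By]; apply/seteqP; split=> [_ [x [Ax _] <-]//|x Ax].
by exists (row_mx x y); rewrite ?row_mxKl //; split; rewrite ?row_mxKl ?row_mxKr.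
Qed.

Lemma rset_prod n m (A : set 'rV[R]_n) (B : set 'rV[R]_m) :
  A !=set0 -> rset (prod_set A B) = B.
Proof.
move=> [y Ay]; apply/seteqP; split=> [_ [x [_ Bx] <-]//|x Bx].
by exists (row_mx y x); rewrite ?row_mxKr //; split; rewrite ?row_mxKl ?row_mxKr.
Qed.

Lemma prod_set_ne n m (A : set 'rV[R]_n) (B : set 'rV[R]_m) :
  A !=set0 -> B !=set0 -> prod_set A B !=set0.
Proof.
by move=> [x Ax] [y By]; exists (row_mx x y); split; rewrite ?row_mxKl ?row_mxKr.
Qed.

Lemma lset_mono n m (A B : set 'rV[R]_(n + m)) : A `<=` B -> lset A `<=` lset B.
Proof. by move=> AB _ [x /AB Bx <-]; exists x. Qed.

Lemma rset_mono n m (A B : set 'rV[R]_(n + m)) : A `<=` B -> rset A `<=` rset B.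
Proof. by move=> AB _ [x /AB Bx <-]; exists x. Qed.

Lemma prod_set_mono n m (A A' : set 'rV[R]_n) (B B' : set 'rV[R]_m) :
  A `<=` A' -> B `<=` B' -> prod_set A B `<=` prod_set A' B'.
Proof. by move=> AA BB x [/AA ? /BB ?]. Qed.

Lemma nfaces_prod n m (P : set 'rV[R]_n) (Q : set 'rV[R]_m) F G :
  nfaces P F -> nfaces Q G -> nfaces (prod_set P Q) (prod_set F G).
Proof.
move=> [[a [c [Pa ->]]] F0] [[b [d [Qb ->]]] G0]; split; last exact: prod_set_ne.
exists (row_mx a b), (c + d); split=> [x [Px Qx] /=|].
  by rewrite dotp_split row_mxKl row_mxKr lerD //; [exact: Pa|exact: Qb].
apply/seteqP; split=> [x [[Px ax] [Qx bx]]|x [[Px Qx] /=]].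
  by split=> //=; rewrite dotp_split row_mxKl row_mxKr ax bx.
rewrite dotp_split row_mxKl row_mxKr => E.
have {}Pa := Pa _ Px; have {}Qb := Qb _ Qx; rewrite /= in Pa Qb.
have ac : dotp a (lsubmx x) = c.
  apply/eqP; rewrite eq_le Pa /= -(lerD2r (dotp b (rsubmx x))) E.
  by rewrite lerD2l.
split; split=> //=; apply: (addrI c); by rewrite -{1}ac.
Qed.

Lemma nfaces_prodP n m (P : set 'rV[R]_n) (Q : set 'rV[R]_m) H :
  nfaces (prod_set P Q) H ->
  [/\ nfaces P (lset H), nfaces Q (rset H) & H = prod_set (lset H) (rset H)].
Proof.
move=> [[a [c [Ha ->]]] [z [[Pz Qz] /= az]]].
set H' := _ `&` _.
pose F := P `&` [set x | dotp (lsubmx a) x = dotp (lsubmx a) (lsubmx z)].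
pose G := Q `&` [set x | dotp (rsubmx a) x = dotp (rsubmx a) (rsubmx z)].
have FP : nfaces P F.
  split; last by exists (lsubmx z).
  exists (lsubmx a), (dotp (lsubmx a) (lsubmx z)); split=> // x Px /=.
  have /Ha /= : prod_set P Q (row_mx x (rsubmx z)).
    by split; rewrite ?row_mxKl ?row_mxKr.
  by rewrite dotp_row -az (dotp_split a z) lerD2r.
have GQ : nfaces Q G.
  split; last by exists (rsubmx z).
  exists (rsubmx a), (dotp (rsubmx a) (rsubmx z)); split=> // x Qx /=.
  have /Ha /= : prod_set P Q (row_mx (lsubmx z) x).
    by split; rewrite ?row_mxKl ?row_mxKr.
  by rewrite dotp_row -az (dotp_split a z) lerD2l.
suff -> : H' = prod_set F G.
  by rewrite lset_prod ?rset_prod //; [case: FP|case: GQ].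
apply/seteqP; split=> [x [[Px Qx] /= ax]|x [[Px /= ax] [Qx /= bx]]]; last first.
  by split=> //=; rewrite dotp_split ax bx -dotp_split.
have [[_ [_ [_ _]]] _] := FP.
have lx : dotp (lsubmx a) (lsubmx x) <= dotp (lsubmx a) (lsubmx z).
  have /Ha /= : prod_set P Q (row_mx (lsubmx x) (rsubmx z)).
    by split; rewrite ?row_mxKl ?row_mxKr.
  by rewrite dotp_row -az (dotp_split a z) lerD2r.
have rx : dotp (rsubmx a) (rsubmx x) <= dotp (rsubmx a) (rsubmx z).
  have /Ha /= : prod_set P Q (row_mx (lsubmx z) (rsubmx x)).
    by split; rewrite ?row_mxKl ?row_mxKr.
  by rewrite dotp_row -az (dotp_split a z) lerD2l.
move: ax; rewrite -az (dotp_split a x) (dotp_split a z) => E.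
have lE : dotp (lsubmx a) (lsubmx x) = dotp (lsubmx a) (lsubmx z).
  apply/eqP; rewrite eq_le lx /= -(lerD2r (dotp (rsubmx a) (rsubmx z))) -E.
  by rewrite lerD2l.
split; split=> //=; move: E; rewrite lE; exact: addrI.
Qed.

Lemma comb_ne_prod n m n' m' (P : set 'rV[R]_n) (Q : set 'rV[R]_m)
    (P' : set 'rV[R]_n') (Q' : set 'rV[R]_m') :
  comb_ne P P' -> comb_ne Q Q' -> comb_ne (prod_set P Q) (prod_set P' Q').
Proof.
move=> [f [g [fP gP fm gm]]] [f' [g' [fP' gP' fm' gm']]].
exists (fun H => prod_set (f (lset H)) (f' (rset H))).
exists (fun H => prod_set (g (lset H)) (g' (rset H))).
split=> [H|H|H H'|H H'].
- move=> /nfaces_prodP[lP rQ HE].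
  have [nf gf] := fP _ lP; have [nf' gf'] := fP' _ rQ.
  split; first exact: nfaces_prod.
  by rewrite lset_prod ?rset_prod ?gf ?gf' //; [case: nf|case: nf'].
- move=> /nfaces_prodP[lP rQ HE].
  have [nf gf] := gP _ lP; have [nf' gf'] := gP' _ rQ.
  split; first exact: nfaces_prod.
  by rewrite lset_prod ?rset_prod ?gf ?gf' //; [case: nf|case: nf'].
- move=> /nfaces_prodP[? ? _] /nfaces_prodP[? ? _] HH.
  by apply: prod_set_mono; [apply: fm|apply: fm'] => //;
    [exact: lset_mono|exact: rset_mono].
- move=> /nfaces_prodP[? ? _] /nfaces_prodP[? ? _] HH.
  by apply: prod_set_mono; [apply: gm|apply: gm'] => //;
    [exact: lset_mono|exact: rset_mono].
Qed.

Lemma comb_ne_prodC n m (P : set 'rV[R]_n) (Q : set 'rV[R]_m) :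
  comb_ne (prod_set P Q) (prod_set Q P).
Proof.
exists (fun H => prod_set (rset H) (lset H)), (fun H => prod_set (rset H) (lset H)).
split=> [H|H|H H' _ _ HH|H H' _ _ HH].
- move=> /nfaces_prodP[lP rQ HE]; split; first exact: nfaces_prod.
  by rewrite lset_prod ?rset_prod //; [case: rQ|case: lP].
- move=> /nfaces_prodP[lP rQ HE]; split; first exact: nfaces_prod.
  by rewrite lset_prod ?rset_prod //; [case: rQ|case: lP].
- by apply: prod_set_mono; [exact: rset_mono|exact: lset_mono].
- by apply: prod_set_mono; [exact: rset_mono|exact: lset_mono].
Qed.

Lemma comb_ne_prodA n m k (P : set 'rV[R]_n) (Q : set 'rV[R]_m)
    (T : set 'rV[R]_k) :
  comb_ne (prod_set P (prod_set Q T)) (prod_set (prod_set P Q) T).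
Proof.
exists (fun H => prod_set (prod_set (lset H) (lset (rset H))) (rset (rset H))).
exists (fun H => prod_set (lset (lset H)) (prod_set (rset (lset H)) (rset H))).
split=> [H|H|H H' _ _ HH|H H' _ _ HH].
- move=> /nfaces_prodP[lP /nfaces_prodP[lQ rQ rE] HE].
  have nl := lP.2; have nlr := lQ.2; have nrr := rQ.2.
  split; first by do !apply: nfaces_prod.
  by rewrite !(lset_prod, rset_prod) // -?rE -?HE //; exact: prod_set_ne.
- move=> /nfaces_prodP[/nfaces_prodP[lQ rQ rE] lP HE].
  have nl := lP.2; have nlr := lQ.2; have nrr := rQ.2.
  split; first by do !apply: nfaces_prod.
  by rewrite !(lset_prod, rset_prod) // -?rE -?HE //; exact: prod_set_ne.
- by repeat first [apply: prod_set_mono|apply: lset_mono|apply: rset_mono].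
- by repeat first [apply: prod_set_mono|apply: lset_mono|apply: rset_mono].
Qed.


Lemma bounded_coordP n (A : set 'rV[R]_n) :
  bounded_set A <-> exists M : R, forall x, A x -> forall i, `|x 0 i| <= M.
Proof.
split=> [/ex_strict_bound_gt0[M M0 AM]|[M AM]].
  exists M => x Ax i; apply: le_trans (ltW (AM x Ax)).
  rewrite [leRHS]mx_normrE.
  exact: (le_bigmax _ (fun ij : 'I_1 * 'I_n => `|x ij.1 ij.2|) (0, i)).
exists `|M|; split=> [|N MN x Ax /=]; first exact: num_real.
rewrite [leLHS]mx_normrE; apply/bigmax_leP; split=> [|[i j] _ /=].
  exact: le_trans (ltW MN).
rewrite ord1; apply: le_trans (AM _ Ax j) _.
exact: le_trans (ler_norm M) (ltW MN).
Qed.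

Lemma is_polytope_prod n m (P : set 'rV[R]_n) (Q : set 'rV[R]_m) :
  is_polytope P -> is_polytope Q -> is_polytope (prod_set P Q).
Proof.
move=> [P0 Pb [I [a [b PE]]]] [Q0 Qb [J [c [d QE]]]].
split; first exact: prod_set_ne.
- have [M PM] := (bounded_coordP P).1 Pb; have [N QN] := (bounded_coordP Q).1 Qb.
  apply/bounded_coordP; exists (Num.max M N) => x [Px Qx] i.
  rewrite -(hsubmxK x); case: (splitP i) => j ij.
    rewrite (_ : i = lshift m j) ?row_mxEl; last exact/val_inj.
    by rewrite le_max PM.
  rewrite (_ : i = rshift n j) ?row_mxEr; last exact/val_inj.
  by rewrite le_max QN ?orbT.
- exists (I + J)%type, (fun k => match k with inl i => row_mx (a i) 0
                                            | inr j => row_mx 0 (c j) end).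
  exists (fun k => match k with inl i => b i | inr j => d j end).
  apply/seteqP; split=> [x [Px Qx] [i|j]|x H].
  + move: Px; rewrite PE => /(_ i) /=.
    by rewrite dotp_split row_mxKl row_mxKr dotp0 addr0.
  + move: Qx; rewrite QE => /(_ j) /=.
    by rewrite dotp_split row_mxKl row_mxKr dotp0 add0r.
  + split; rewrite ?PE ?QE => i.
      by have := H (inl i); rewrite /= dotp_split row_mxKl row_mxKr dotp0 addr0.
    by have := H (inr i); rewrite /= dotp_split row_mxKl row_mxKr dotp0 add0r.
Qed.

Lemma is_polytope_point : is_polytope [set: 'rV[R]_0].
Proof.
split; first by exists 0.
- by apply/bounded_coordP; exists 0 => x _ [].
- exists 'I_0, (fun=> 0), (fun=> 0).
  by apply/seteqP; split=> // x _ [].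
Qed.

Lemma dotpD n (a x y : 'rV[R]_n) : dotp a (x + y) = dotp a x + dotp a y.
Proof.
by rewrite /dotp -big_split; apply: eq_bigr => i _; rewrite mxE mulrDr.
Qed.

Lemma dotpZ n (a x : 'rV[R]_n) r : dotp a (r *: x) = r * dotp a x.
Proof.
by rewrite /dotp mulr_sumr; apply: eq_bigr => i _; rewrite mxE mulrCA.
Qed.

Lemma dotpN n (a x : 'rV[R]_n) : dotp a (- x) = - dotp a x.
Proof. by rewrite -scaleN1r dotpZ mulN1r. Qed.

Lemma dotp_sum n (I : finType) (a : 'rV[R]_n) (x : I -> 'rV[R]_n) :
  dotp a (\sum_i x i) = \sum_i dotp a (x i).
Proof.
rewrite /dotp exchange_big /=; apply: eq_bigr => j _.
by rewrite summxE mulr_sumr.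
Qed.

(* A nonempty face is cut out by turning some of the given inequalities into
   equalities. *)
Lemma nfaces_active n (P : set 'rV[R]_n) (I : finType) (a : I -> 'rV[R]_n)
    (b : I -> R) F :
  P = [set x | forall i, dotp (a i) x <= b i] -> nfaces P F ->
  exists J : {set I}, F = P `&` [set x | forall i, i \in J -> dotp (a i) x = b i].
Proof.
move=> PE [[a0 [c [Pc FE]]] [p0 Fp0]].
have FP : F `<=` P by rewrite FE => x [].
have PP i x : P x -> dotp (a i) x <= b i by rewrite PE; apply.
pose J : {set I} := finset (fun i => `[< forall x, F x -> dotp (a i) x = b i >]).
exists J; apply/seteqP; split=> [x Fx|y [Py /= yJ]].
  by split=> [|i /=]; [exact: FP|rewrite finset.inE => /asboolP; apply].
have /choice[x xP] (i : I) :
    exists x, F x /\ (i \notin J -> dotp (a i) x < b i).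
  have [iJ|iJ] := boolP (i \in J); first by exists p0.
  move: iJ; rewrite finset.inE => /asboolPn/existsNP[x /not_implyP[Fx xi]].
  exists x; split=> // _; rewrite lt_neqAle PP ?andbT; last exact: FP.
  exact/eqP.
pose s : 'rV[R]_n := p0 + \sum_i x i.
pose N : R := (#|I|.+1)%:R.
have N0 : 0 < N by rewrite ltr0n.
pose p := N^-1 *: s.
have pE u : dotp u p = N^-1 * (dotp u p0 + \sum_i dotp u (x i)).
  by rewrite dotpZ dotpD dotp_sum.
have avg (r : R) : N^-1 * (r + \sum_(i : I) r) = r.
  rewrite sumr_const -mulrS -[r in r *+ _]mulr1 -mulrnAr mulrC -mulrA divff ?mulr1 //.
  exact: lt0r_neq0.
have pc : dotp a0 p = c.
  rewrite pE -[RHS]avg; congr (_ * (_ + _)).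
    by move: Fp0; rewrite FE => -[].
  by apply: eq_bigr => i _; have [] := xP i; rewrite FE => -[].
have pJ i : i \in J -> dotp (a i) p = b i.
  rewrite finset.inE => /asboolP iJ; rewrite pE -[RHS]avg iJ //.
  congr (_ * (_ + _)); apply: eq_bigr => j _; rewrite iJ //.
  by have [] := xP j.
have pN i : i \notin J -> dotp (a i) p < b i.
  move=> iJ; rewrite pE -[ltRHS]avg ltr_pM2l ?invr_gt0 //.
  rewrite ler_ltD ?PP //; first exact: FP.
  rewrite (bigD1 i) //= [ltRHS](bigD1 i) //= ltr_leD //.
    by have [_] := xP i; apply.
  apply: ler_sum => j _; apply: PP; apply: FP.
  by have [] := xP j.
clearbody p.
pose m := \big[Num.min/1]_(i | i \notin J) (b i - dotp (a i) p).
have m0 : 0 < m.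
  apply: lt_bigmin => [|i iJ]; first exact: ltr01.
  by rewrite subr_gt0 pN.
pose M := 1 + \sum_i `|dotp (a i) (p - y)|.
have M0 : 0 < M by rewrite ltr_pwDl // sumr_ge0.
pose e := m / M.
have e0 : 0 < e by rewrite divr_gt0.
have Pq : P (p + e *: (p - y)).
  rewrite PE => i /=; rewrite dotpD dotpZ.
  have [iJ|iJ] := boolP (i \in J).
    by rewrite dotpD dotpN pJ // yJ // subrr mulr0 addr0.
  rewrite addrC -lerBrDr (@le_trans _ _ m) //.
    2: exact: bigmin_le_cond.
  rewrite /e -mulrA ger_pMr // mulrC ler_pdivrMr // mul1r.
  apply: le_trans (ler_norm _) _.
  rewrite /M (bigD1 i) //= addrCA lerDl addr_ge0 // sumr_ge0 //.
have := Pc _ Pq; rewrite /= dotpD dotpZ dotpD dotpN pc gerDl pmulr_rle0 //.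
rewrite subr_le0 => cy; rewrite FE; split=> //=.
by apply/eqP; rewrite eq_le cy andbT; exact: Pc.
Qed.

Lemma faces_active n (P : set 'rV[R]_n) (I : finType) (a : I -> 'rV[R]_n)
    (b : I -> R) (J : {set I}) :
  P = [set x | forall i, dotp (a i) x <= b i] ->
  faces P (P `&` [set x | forall i, i \in J -> dotp (a i) x = b i]).
Proof.
move=> PE; have PP i x : P x -> dotp (a i) x <= b i by rewrite PE; apply.
exists (\sum_(i in J) a i), (\sum_(i in J) b i).
have sE x : dotp (\sum_(i in J) a i) x = \sum_(i in J) dotp (a i) x.
  rewrite /dotp exchange_big /=; apply: eq_bigr => j _.
  by rewrite summxE mulr_suml.
split=> [x Px /=|]; first by rewrite sE; apply: ler_sum => i _; exact: PP.
apply/seteqP; split=> x [Px /=]; rewrite sE => E; split=> //=.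
  exact: eq_bigr.
have : \sum_(i in J) (b i - dotp (a i) x) = 0 by rewrite sumrB E subrr.
move/psumr_eq0P => H i iJ; apply/esym/eqP; rewrite -subr_eq0; apply/eqP.
by apply: H => // j _; rewrite subr_ge0 PP.
Qed.

Lemma nface_rep n (P : set 'rV[R]_n) (I : finType) (a : I -> 'rV[R]_n)
    (b : I -> R) (J : {set I}) :
  P = [set x | forall i, dotp (a i) x <= b i] ->
  P `&` [set x | forall i, i \in J -> dotp (a i) x = b i] =
  [set x | forall k : I + I,
     dotp (match k with inl i => a i | inr i => if i \in J then - a i else 0 end) x
     <= match k with inl i => b i | inr i => if i \in J then - b i else 0 end].
Proof.
have dN u x : dotp (- u) x = - dotp u x :> R.
  by rewrite /dotp -sumrN; apply: eq_bigr => i _; rewrite mxE mulNr.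
move=> ->; apply/seteqP; split=> [x [/= Px Jx] [i|i] //=|x /= H].
  case: ifP => [iJ|_]; last by rewrite dotp0.
  by rewrite dN Jx.
split=> [i|i iJ]; first exact: (H (inl i)).
apply/eqP; rewrite eq_le (H (inl i)) /= -lerN2 -dN.
by have := H (inr i); rewrite iJ.
Qed.

Lemma nface_polytope n (P F : set 'rV[R]_n) :
  is_polytope P -> nfaces P F -> is_polytope F.
Proof.
move=> [_ Pb [I [a [b PE]]]] PF; have FP := faces_sub PF.1; split.
- by case: PF.
- have [M PM] := (bounded_coordP P).1 Pb.
  by apply/bounded_coordP; exists M => x /FP; exact: PM.
- have [J ->] := nfaces_active PE PF.
  rewrite (nface_rep J PE); exists (I + I)%type; eexists; eexists; exact: erefl.
Qed.

Lemma nface_trans n (P F G : set 'rV[R]_n) : is_polytope P -> nfaces P F ->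
  nfaces F G <-> nfaces P G /\ G `<=` F.
Proof.
move=> [_ _ [I [a [b PE]]]] PF; have FP := faces_sub PF.1; split; last first.
  move=> [[[u [c [Pu GE]]] G0] GF]; split=> //; exists u, c.
  split=> [x /FP/Pu//|]; apply/seteqP; split=> [x Gx|x [/FP Px ux]].
    by split; [exact: GF|move: Gx; rewrite GE => -[]].
  by rewrite GE.
move=> FG; split; last exact: faces_sub FG.1.
split; last by case: FG.
have [J FE] := nfaces_active PE PF.
have FE' := FE; rewrite (nface_rep J PE) in FE'.
have [K GE] := nfaces_active FE' FG.
suff -> : G = P `&` [set x | forall i,
    i \in J :|: finset (fun i => inl i \in K) -> dotp (a i) x = b i].
  exact: faces_active.
rewrite GE {1}FE; apply/seteqP; split=> [x [[Px /= Jx] Kx]|x [Px /= H]].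
  split=> //= i; rewrite finset.inE => /orP[/Jx//|].
  by rewrite finset.inE => /Kx.
have Jx i : i \in J -> dotp (a i) x = b i.
  by move=> iJ; apply: H; rewrite finset.inE iJ.
split; first by split.
move=> [i|i] /= iK; first by apply: H; rewrite !finset.inE iK orbT.
case: ifP => [iJ|_]; last by rewrite dotp0.
rewrite -Jx // /dotp -sumrN; apply: eq_bigr => k _; by rewrite mxE mulNr.
Qed.

Lemma polytope_inj n : injective (@polytope_set n).
Proof.
case=> [P p] [Q q] /= PQ; subst Q; congr Polytope.
exact: Prop_irrelevance.
Qed.

Lemma facetsP n (P : set 'rV[R]_n) (F : polytope n) :
  facets P F <-> [/\ nfaces P F, F <> P :> set _ &
     forall G, nfaces P G -> F `<=` G -> G = F \/ G = P].
Proof.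
have F0 : F !=set0 by case: (polytopeP F).
split=> -[PF FP Fm]; split=> //.
- by move=> G [PG _]; exact: Fm.
- by case: PF.
- move=> G PG FG; apply: Fm => //; split=> //.
  by have [x /FG Gx] := F0; exists x.
Qed.

Lemma finite_facets n (P : polytope n) : finite_set (facets P).
Proof.
have [_ _ [I [a [b PE]]]] := polytopeP P.
have fin : finite_set [set F | nfaces (polytope_set P) F].
  pose h (J : {set I}) := P `&` [set x | forall i, i \in J -> dotp (a i) x = b i].
  apply: (@sub_finite_set _ _ (h @` [set: {set I}])).
    by move=> F /(nfaces_active PE)[J ->]; exists J.
  exact/finite_image/finite_finset.
apply: (@sub_finite_set _ _ (@polytope_set n @^-1` [set F | nfaces P F])).
  by move=> F /facetsP[].
apply: finite_preimage => // F G _ _; exact: polytope_inj.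
Qed.

Lemma comb_ne_face n m (P : set 'rV[R]_n) (Q : set 'rV[R]_m) f g F :
  is_polytope P -> is_polytope Q ->
  [/\ forall F, nfaces P F -> nfaces Q (f F) /\ g (f F) = F,
      forall G, nfaces Q G -> nfaces P (g G) /\ f (g G) = G,
      forall F F', nfaces P F -> nfaces P F' -> F `<=` F' -> f F `<=` f F' &
      forall G G', nfaces Q G -> nfaces Q G' -> G `<=` G' -> g G `<=` g G'] ->
  nfaces P F -> comb_ne F (f F).
Proof.
move=> Pp Qp [fP gP fm gm] PF; have [QF gfF] := fP _ PF.
exists f, g; split=> [G|G|G G'|G G'].
- move=> /(nface_trans _ Pp PF)[PG GF]; have [QG gG] := fP _ PG.
  by split=> //; apply/(nface_trans _ Qp QF); split=> //; exact: fm.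
- move=> /(nface_trans _ Qp QF)[QG GF]; have [PG gG] := gP _ QG.
  by split=> //; apply/(nface_trans _ Pp PF); split=> //; rewrite -gfF; exact: gm.
- by move=> /(nface_trans _ Pp PF)[? _] /(nface_trans _ Pp PF)[? _]; exact: fm.
- by move=> /(nface_trans _ Qp QF)[? _] /(nface_trans _ Qp QF)[? _]; exact: gm.
Qed.

Lemma comb_ne_facets n m (P : polytope n) (Q : polytope m) :
  comb_ne P Q -> exists h : polytope n -> polytope m,
    set_bij (facets P) (facets Q) h /\ forall F, facets P F -> comb_ne F (h F).
Proof.
move=> [f [g fg]]; have [fP gP fm gm] := fg.
have nself k (T : polytope k) : nfaces T T.
  by split; [exact: faces_self|case: (polytopeP T)].
have [Pp Qp] := (polytopeP P, polytopeP Q).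
have /choice[h hP] (F : polytope n) :
    exists G : polytope m, nfaces P F -> G = f F :> set _.
  have [PF|nPF] := pselect (nfaces P F); last by exists Q.
  by exists (Polytope (nface_polytope Qp (fP _ PF).1)).
have /choice[k kP] (G : polytope m) :
    exists F : polytope n, nfaces Q G -> F = g G :> set _.
  have [PF|nPF] := pselect (nfaces Q G); last by exists P.
  by exists (Polytope (nface_polytope Pp (gP _ PF).1)).
have fPQ : f P = Q.
  apply/seteqP; split; first exact: faces_sub (fP _ (nself _ P)).1.1.
  have [Pg fgQ] := gP _ (nself _ Q); rewrite -[X in X `<=` _]fgQ.
  by apply: fm => //; exact: faces_sub Pg.1.
have gQP : g Q = P by rewrite -fPQ; apply: (fP _ _).2.
exists h; split; last first.
  move=> F /facetsP[PF _ _]; rewrite hP //.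
  exact: (comb_ne_face Pp Qp fg).
split.
- move=> F /facetsP[PF FP Fm]; have [Qf gf] := fP _ PF.
  apply/facetsP; rewrite hP //; split=> // [E|G QG fG].
    by apply: FP; rewrite -gf E.
  have [Pg fgG] := gP _ QG.
  have [|E|E] := Fm _ Pg; first by rewrite -gf; exact: gm.
    by left; rewrite -fgG E.
  by right; rewrite -fgG E.
- move=> F G; rewrite !inE => /facetsP[PF _ _] /facetsP[PG _ _] E.
  apply: polytope_inj; rewrite -(fP _ PF).2 -(fP _ PG).2.
  by rewrite -(hP _ PF) -(hP _ PG) E.
- move=> G /facetsP[QG GQ Gm]; have [Pg fgG] := gP _ QG.
  have kE := kP _ QG; exists (k G); last first.
    by apply: polytope_inj; rewrite hP kE.
  apply/facetsP; rewrite kE; split=> // [E|F PF gF].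
    by apply: GQ; rewrite -fgG E.
  have [Qf gf] := fP _ PF.
  have [|E|E] := Gm _ Qf; first by rewrite -fgG; exact: fm.
    by left; rewrite -gf E.
  by right; rewrite -gf E.
Qed.

Definition polytope_prod n m (P : polytope n) (Q : polytope m) :
    polytope (n + m) :=
  Polytope (is_polytope_prod (polytopeP P) (polytopeP Q)).

Definition polytope_point : polytope 0 := Polytope is_polytope_point.

Definition comb_rel : rel {n & polytope n} :=
  fun P Q => `[< comb_equiv (tagged P) (tagged Q) >].

Lemma comb_rel_refl : reflexive comb_rel.
Proof. by move=> P; apply/asboolP/comb_equivP/comb_ne_refl. Qed.

Lemma comb_rel_sym : symmetric comb_rel.
Proof.
move=> P Q; apply/idP/idP => /asboolP/comb_equivP/comb_ne_sym H;
  exact/asboolP/comb_equivP.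
Qed.

Lemma comb_rel_trans : transitive comb_rel.
Proof.
move=> Q P T /asboolP/comb_equivP H /asboolP/comb_equivP/(comb_ne_trans H) K.
exact/asboolP/comb_equivP.
Qed.

Canonical comb_rel_equiv := EquivRel comb_rel
  comb_rel_refl comb_rel_sym comb_rel_trans.

Definition comb_type : Type := {eq_quot comb_rel}.
HB.instance Definition _ := Choice.on comb_type.
HB.instance Definition _ := EqQuotient.on comb_type.

Definition comb_class n (P : polytope n) : comb_type :=
  \pi_comb_type (existT _ n P).

Lemma comb_classP n m (P : polytope n) (Q : polytope m) :
  comb_class P = comb_class Q <-> comb_equiv P Q.
Proof.
split=> [/eqmodP/asboolP//|PQ]; by apply/eqmodP/asboolP.
Qed.

Lemma comb_classE (c : comb_type) : comb_class (tagged (repr c)) = c.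
Proof. by rewrite -[RHS]reprK; case: (repr c). Qed.

Lemma comb_class_repr n (P : polytope n) :
  comb_equiv (tagged (repr (comb_class P))) P.
Proof. by apply/comb_classP; rewrite comb_classE. Qed.

Definition comb_mul (c c' : comb_type) : comb_type :=
  comb_class (polytope_prod (tagged (repr c)) (tagged (repr c'))).

Lemma comb_mulE n m (P : polytope n) (Q : polytope m) :
  comb_mul (comb_class P) (comb_class Q) = comb_class (polytope_prod P Q).
Proof.
apply/comb_classP/comb_equivP; apply: comb_ne_prod;
  exact/comb_equivP/comb_class_repr.
Qed.

Definition comb_one : comb_type := comb_class polytope_point.

Lemma comb_mulC : commutative comb_mul.
Proof. by move=> c c'; exact/comb_classP/comb_equivP/comb_ne_prodC. Qed.

Lemma comb_mulA : associative comb_mul.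
Proof.
move=> c c' c''.
rewrite -(comb_classE c) -(comb_classE c') -(comb_classE c'') !comb_mulE.
exact/comb_classP/comb_equivP/comb_ne_prodA.
Qed.

Lemma nfaces_point F : nfaces [set: 'rV[R]_0] F <-> F = setT.
Proof.
split=> [[_ [x Fx]]|->].
  by apply/seteqP; split=> // y _; rewrite (_ : y = x) //; apply/rowP => -[].
by split; [exact: faces_self|exists 0].
Qed.

Lemma comb_mul1 : left_id comb_one comb_mul.
Proof.
move=> c; rewrite -(comb_classE c) comb_mulE.
move: (tagged (repr c)) => P; apply/comb_classP/comb_equivP.
exists (@rset 0 _), (fun F => prod_set [set: 'rV[R]_0] F).
have T0 : [set: 'rV[R]_0] !=set0 by exists 0.
split=> [H|H PH|H H' _ _|H H' _ _ HH].
- move=> /nfaces_prodP[/nfaces_point lE rQ HE]; split; first exact: rQ.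
  by rewrite -lE -HE.
- split; last by rewrite rset_prod.
  by apply: nfaces_prod PH; exact/nfaces_point.
- exact: rset_mono.
- exact: prod_set_mono.
Qed.

Lemma comb_mul_eq1 c c' :
  comb_mul c c' = comb_one -> c = comb_one /\ c' = comb_one.
Proof.
suff H b b' : comb_mul b b' = comb_one -> b = comb_one.
  by move=> E; split; [exact: H E|move: E; rewrite comb_mulC; exact: H].
rewrite -(comb_classE b) -(comb_classE b') comb_mulE.
move: (tagged (repr b)) (tagged (repr b')) => P Q.
move=> /comb_classP/comb_equivP[f [g [fP _ _ _]]].
apply/comb_classP/comb_equivP.
have [P0 Q0] : P !=set0 /\ Q !=set0 by case: (polytopeP P); case: (polytopeP Q).
have nQ : nfaces Q Q by split; [exact: faces_self|].
have nP : nfaces P P by split; [exact: faces_self|].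
have one F : nfaces P F -> F = P.
  move=> PF; have [/nfaces_point fF gF] := fP _ (nfaces_prod PF nQ).
  have [/nfaces_point fP' gP'] := fP _ (nfaces_prod nP nQ).
  by rewrite -(lset_prod F Q0) -gF fF -fP' gP' lset_prod.
exists (fun=> setT), (fun=> polytope_set P); split=> [|||].
- by move=> F /one ->; split=> //; exact/nfaces_point.
- by move=> G /nfaces_point ->.
- by move=> *; exact: subset_refl.
- by move=> *; exact: subset_refl.
Qed.

HB.instance Definition _ := Choice_isMonomialDef.Build comb_type
  comb_mulA comb_mul1 (fun c => etrans (comb_mulC c comb_one) (comb_mul1 c))
  comb_mul_eq1.
HB.instance Definition _ := MonomialDef_isConomialDef.Build comb_type comb_mulC.

(* The free abelian group on [comb_type]; its product is determined by [pgenM]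
   and its unit by [pgen1] below. *)
Definition pring : Type := malg comb_type int.
HB.instance Definition _ := GRing.ComNzRing.on pring.

Definition pgen n (P : polytope n) : pring := mkmalgU (comb_class P) 1.

Definition facet_sum n (P : polytope n) : pring :=
  \sum_(F \in facets P) pgen F.

(* By [facet_sum_equiv] the choice of representatives is immaterial, and
   [pder_gen] gives the value on each polytope. *)
Definition pder (x : pring) : pring :=
  \sum_(c <- finmap.enum_fset (msupp x))
    facet_sum (tagged (repr c)) *~ mcoeff c x.

Lemma facet_sum_equiv n m (P : polytope n) (Q : polytope m) :
  comb_equiv P Q -> facet_sum P = facet_sum Q.
Proof.
move=> /comb_equivP/comb_ne_facets[h [hb hE]].
rewrite /facet_sum (reindex_fsbig h _ _ _ hb); apply: eq_fsbigr => F.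
by rewrite inE => /hE/comb_equivP/comb_classP; rewrite /pgen => ->.
Qed.

Lemma pder_gen n (P : polytope n) : pder (pgen P) = facet_sum P.
Proof.
rewrite /pder /pgen msuppU1 /= finmap.big_seq_fset1 mcoeffUU.
exact/facet_sum_equiv/comb_class_repr.
Qed.

Lemma pgenM n m (P : polytope n) (Q : polytope m) :
  pgen P * pgen Q = pgen (polytope_prod P Q).
Proof. by rewrite /pgen -comb_mulE [LHS]fgmulUU mulr1. Qed.

Lemma pgen1 : pgen polytope_point = 1.
Proof. by []. Qed.

End Polytopes.

Definition subring_gen (A : pzRingType) (X : set A) : set A :=
  smallest (fun U : set A => GRing.subring_closed [pred x in U]) X.

Definition connected_graph (T : finType) (e : rel T) : Prop :=
  [/\ symmetric e, irreflexive e & forall x y, connect e x y].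

Definition building (T : finType) (e : rel T) (S : {set T}) : bool :=
  (S != finset.set0) &&
  [forall x in S, forall y in S,
     connect [rel u v | [&& u \in S, v \in S & e u v]] x y].

Definition graph_assoc_set (R : realType) (n : nat) (e : rel 'I_n) :
    set 'rV[R]_n :=
  [set x | \sum_i x 0 i = 3 ^+ n /\
     forall S : {set 'I_n}, building e S -> S != finset.setT ->
       3 ^+ #|S| <= \sum_(i in S) x 0 i].

Lemma building1 (T : finType) (e : rel T) (i : T) : building e (finset.set1 i).
Proof.
apply/andP; split; first by apply/finset.set0Pn; exists i; rewrite finset.inE.
apply/forall_inP => x; rewrite finset.inE => /eqP ->.
by apply/forall_inP => y; rewrite finset.inE => /eqP ->.
Qed.

Lemma graph_assoc_ge0 (R : realType) n (e : rel 'I_n) (x : 'rV[R]_n) i :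
  graph_assoc_set e x -> 0 <= x 0 i.
Proof.
move=> [xT xS]; have [iT|iT] := eqVneq (finset.set1 i) finset.setT.
  have -> : x 0 i = \sum_j x 0 j.
    transitivity (\sum_(j in finset.set1 i) x 0 j); first by rewrite big_set1.
    rewrite iT; by apply: eq_bigl => j; rewrite finset.in_setT.
  by rewrite xT exprn_ge0.
have := xS _ (building1 e i) iT; rewrite finset.cards1 big_set1 expr1.
exact: le_trans.
Qed.

Lemma graph_assoc_bounded (R : realType) n (e : rel 'I_n) :
  bounded_set (graph_assoc_set (R := R) e).
Proof.
apply/bounded_coordP; exists (3 ^+ n) => x xP i.
rewrite ger0_norm; last exact: graph_assoc_ge0 xP.
case: (xP) => <- _; rewrite (bigD1 i) //= lerDl sumr_ge0 // => j _.
exact: graph_assoc_ge0 xP.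
Qed.

Lemma exp3_ratio (s n : nat) :
  (0 < s)%N -> (s <= n)%N -> (n * 3 ^ s <= s * 3 ^ n)%N.
Proof.
move=> s0 /subnKC <-; move: (n - s)%N => d.
rewrite expnD mulnCA [leqLHS]mulnC leq_pmul2l ?expn_gt0 //.
apply: (@leq_trans (s * d.+1)%N); last by rewrite leq_pmul2l // ltn_expl.
by rewrite mulnS leq_add2l leq_pmull.
Qed.

Lemma graph_assoc_nonempty (R : realType) n (e : rel 'I_n.+1) :
  graph_assoc_set (R := R) e !=set0.
Proof.
pose r : R := 3 ^+ n.+1 / n.+1%:R.
have sumr (S : {set 'I_n.+1}) :
    \sum_(i in S) (const_mx r : 'rV[R]_n.+1) 0 i = r *+ #|S|.
  by rewrite -sumr_const; apply: eq_bigr => i _; rewrite mxE.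
exists (const_mx r); split.
  rewrite (eq_bigr (fun=> r)) => [|i _]; last by rewrite mxE.
  by rewrite sumr_const card_ord -[LHS]mulr_natr /r divfK // pnatr_eq0.
move=> S /andP[S0 _] _; rewrite sumr -[leRHS]mulr_natr /r mulrAC.
rewrite ler_pdivlMr ?ltr0n // -!natrX -!natrM ler_nat mulnC [leqRHS]mulnC.
apply: exp3_ratio; first by rewrite finset.card_gt0.
by have := max_card S; rewrite card_ord.
Qed.

Lemma graph_assoc_is_polytope (R : realType) n (e : rel 'I_n.+1) :
  is_polytope (graph_assoc_set (R := R) e).
Proof.
split; [exact: graph_assoc_nonempty|exact: graph_assoc_bounded|].
pose ind (S : {set 'I_n.+1}) : 'rV[R]_n.+1 := \row_i (i \in S)%:R.
have indE S x : dotp (ind S) x = \sum_(i in S) x 0 i.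
  rewrite /dotp [RHS]big_mkcond; apply: eq_bigr => i _; rewrite mxE.
  by case: (i \in S); rewrite ?mul1r ?mul0r.
have NindE S x : dotp (- ind S) x = - \sum_(i in S) x 0 i.
  by rewrite -indE /dotp -sumrN; apply: eq_bigr => i _; rewrite mxE mulNr.
have sumT (x : 'rV[R]_n.+1) : \sum_(i in finset.setT) x 0 i = \sum_i x 0 i.
  by apply: eq_bigl => i; rewrite finset.in_setT.
pose good S := building e S && (S != finset.setT).
exists (bool + {set 'I_n.+1})%type.
exists (fun k => match k with
  | inl b => if b then ind finset.setT else - ind finset.setT
  | inr U => if good U then - ind U else 0 end).
exists (fun k => match k with
  | inl b => if b then 3 ^+ n.+1 else - 3 ^+ n.+1
  | inr U => if good U then - 3 ^+ #|U| else 0 end).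
apply/seteqP; split=> [x [xT xS] [[|]|S]|x /= H].
- by rewrite indE sumT xT.
- by rewrite NindE sumT xT.
- case: ifP => [/andP[? ?]|_]; last by rewrite dotp0.
  by rewrite NindE lerN2 xS.
split=> [|S BS ST].
  have := H (inl true); have := H (inl false).
  rewrite NindE indE sumT lerN2 => a b.
  by apply/eqP; rewrite eq_le b a.
have := H (inr S); rewrite /good BS ST /= NindE lerN2; exact.
Qed.

Definition graph_assoc (R : realType) n (e : rel 'I_n.+1) : polytope R n.+1 :=
  Polytope (graph_assoc_is_polytope R e).

Definition path_graph n : rel 'I_n :=
  fun i j => (i.+1 == j :> nat) || (j.+1 == i :> nat).

Definition complete_graph n : rel 'I_n := fun i j => i != j.

(* [associahedron R k] and [permutohedron R k] are k-dimensional: they come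
   from graphs with [k.+1] vertices. *)
Definition associahedron (R : realType) (k : nat) : polytope R k.+1 :=
  graph_assoc R (@path_graph k.+1).

Definition permutohedron (R : realType) (k : nat) : polytope R k.+1 :=
  graph_assoc R (@complete_graph k.+1).

(* Main.v *)
Require Import Defs.
From mathcomp Require Import all_boot all_order all_algebra fingroup perm.
From mathcomp Require Import boolp classical_sets reals.
From mathcomp Require Import functions cardinality fsbigop topology normedtype.
From mathcomp Require Import derive.
From mathcomp Require Import -(notations) monalg.
From mathcomp Require Import zify lra.

(** The subring is spanned by the monomials in the [P k], so closure under [d]
    forces the class of every facet, hence of every nonempty face, of each
    [P k] to be a monomial.  The number of vertices is multiplicative and
    invariant under combinatorial equivalence, so the numbers of vertices of
    the faces are products of those of the [P k].  These are 1 and 2 for k = 0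
    and k = 1, and at least [2 ^ k] in general.  If the graph on three vertices
    is a path, [P 2] has 5 vertices and no face has 6 of them; but a connected
    graph on at least four vertices which is not a path has disjoint connected
    [D] and vertices [a], [b], [c] that become a triangle once [D] is
    contracted, which gives a hexagonal face.  If the graph on three vertices is
    complete, [P 2] has at least 6 vertices and no face has 5 of them; but an
    induced path on three vertices in a graph gives a pentagonal face. *)

Set Implicit Arguments.
Unset Strict Implicit.
Unset Printing Implicit Defensive.

Import Order.TTheory GRing.Theory Num.Theory numFieldNormedType.Exports.
Local Open Scope classical_set_scope.
Local Open Scope ring_scope.

(** Facets enter [d] with positive coefficients, so nothing cancels and every facet class is in the
    support of an element of the subring. Faces are not described as products of smaller
    graph-associahedra; the argument is carried out in coordinates. A sequence of vertices, each
    adjacent to an earlier one, gives a chain of connected sets, and the point where all their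
    inequalities become equalities is a vertex. The right-hand sides [3 ^ k] make this explicit: the
    vertex added to [k > 0] others has coordinate [3 ^ k.+1 - 3 ^ k = 2 * 3 ^ k], which on its own
    satisfies the inequality of any set of at most [k] vertices containing it. Dropping two
    consecutive sets from the chain leaves a face on which only three coordinates vary. Its vertices
    are listed by hand, and the list is complete because every linear functional attains its maximum
    over the face at a listed point. The obstacle is a corner at which a vertex without neighbours
    in the contracted set [D] would come next: its union with [D] is disconnected, so the tight sets
    there no longer form a chain and the corner needs its own verification. *)

Section SubringGen.
Variables (A : pzRingType) (X : set A).

Lemma subring_gen_sub : X `<=` subring_gen X.
Proof. by move=> x Xx U [_ XU]; exact: XU. Qed.

Lemma subring_gen_closed : GRing.subring_closed [pred x in subring_gen X].
Proof.
split=> [|x y|x y]; rewrite !inE.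
- by move=> U [[U1 _ _] _]; move: U1; rewrite !inE.
- move=> Ax Ay U cU; have [[_ UB _] _] := cU.
  by have := UB x y; rewrite !inE; apply; [exact: Ax|exact: Ay].
- move=> Ax Ay U cU; have [[_ _ UM] _] := cU.
  by have := UM x y; rewrite !inE; apply; [exact: Ax|exact: Ay].
Qed.

Lemma subring_gen_min (U : set A) :
  GRing.subring_closed [pred x in U] -> X `<=` U -> subring_gen X `<=` U.
Proof. by move=> cU XU x; apply. Qed.

Lemma subring_gen1 : subring_gen X 1.
Proof. by have [+ _ _] := subring_gen_closed; rewrite inE. Qed.

Lemma subring_genM x y :
  subring_gen X x -> subring_gen X y -> subring_gen X (x * y).
Proof.
have [_ _ AM] := subring_gen_closed.
by move=> Ax Ay; have := AM x y; rewrite !inE; apply.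
Qed.

End SubringGen.

(** * Monomials in the generators and the classes of faces *)

Section Monomials.
Variables (R : realType) (c : nat -> comb_type R).

Definition comb_prod (s : seq nat) : comb_type R :=
  foldr (fun k => comb_mul (c k)) (comb_one R) s.

Lemma comb_prod_cat s t :
  comb_mul (comb_prod s) (comb_prod t) = comb_prod (s ++ t).
Proof. by elim: s => [|k s IH] /=; rewrite ?comb_mul1 // -comb_mulA IH. Qed.

Let P k : pring R := mkmalgU (c k) 1.

Lemma mkmalgU_mul (a b : comb_type R) :
  mkmalgU (comb_mul a b) 1 = mkmalgU a 1 * mkmalgU b 1 :> pring R.
Proof. by rewrite [RHS]fgmulUU mulr1. Qed.

Lemma comb_prod_subring_gen s :
  subring_gen (range P) (mkmalgU (comb_prod s) 1 : pring R).
Proof.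
elim: s => [|k s IH] /=; first exact: subring_gen1.
by rewrite mkmalgU_mul; apply: subring_genM IH; apply: subring_gen_sub; exists k.
Qed.

(** The elements supported on monomials form a subring that contains the generators. *)
Lemma subring_gen_supp (x : pring R) : subring_gen (range P) x ->
  forall a, mcoeff a x != 0 -> exists s, a = comb_prod s.
Proof.
pose U : set (pring R) :=
  [set x | forall a, mcoeff a x != 0 -> exists s, a = comb_prod s].
apply: (@subring_gen_min _ _ U) => [|_ [k _ <-] a].
  split=> [|u v|u v]; rewrite !inE /U /=.
  - move=> a; rewrite mcoeff1; case: (a =P _) => [->|_]; last by rewrite eqxx.
    by exists [::].
  - move=> Uu Uv a; rewrite mcoeffB.
    have [/Uu//|/negPn/eqP ->] := boolP (mcoeff a u != 0).
    by rewrite sub0r oppr_eq0 => /Uv.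
  - move=> Uu Uv a; rewrite mcoeff_neq0 => /msuppM_le[a1 [a2 []]].
    rewrite -!mcoeff_neq0 => /Uu[s1 ->] /Uv[s2 ->] ->.
    by exists (s1 ++ s2); rewrite -comb_prod_cat.
rewrite /P mcoeffU; case: (c k =P a) => [<- _|_]; last by rewrite eqxx.
by exists [:: k]; rewrite /= comb_mulC comb_mul1.
Qed.

(** The coefficient counts the facets of [Q] equivalent to [F]: all its terms are nonnegative and
    the one coming from [F] is 1. *)
Lemma facet_sum_supp n (Q F : polytope R n) :
  facets Q F -> mcoeff (comb_class F) (facet_sum Q) != 0.
Proof.
move=> QF; rewrite /facet_sum fsbig_finite; last exact: finite_facets.
rewrite raddf_sum /= gt_eqF //.
have FQ : F \in finmap.enum_fset (fset_set (facets Q)).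
  by rewrite in_fset_set ?inE //; exact: finite_facets.
rewrite (big_rem _ FQ) /= /pgen mcoeffUU ltr_pwDl // sumr_ge0 // => G _.
by rewrite mcoeffU mulrn_wge0.
Qed.

Hypothesis closed : forall x,
  subring_gen (range P) x -> subring_gen (range P) (pder x).

Lemma facet_comb_prod n (Q F : polytope R n) s :
  comb_class Q = comb_prod s -> facets Q F ->
  exists t, comb_class F = comb_prod t.
Proof.
move=> Qs QF; have := closed (comb_prod_subring_gen s).
rewrite -Qs -/(pgen Q) pder_gen => /subring_gen_supp; apply.
exact: facet_sum_supp.
Qed.

(* The polytopes [F] between [G] and [Q] whose class is a monomial are compared
   by the number of given inequalities active on them. *)
Lemma nface_comb_prod n (Q G : polytope R n) s :
  comb_class Q = comb_prod s -> nfaces Q G ->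
  exists t, comb_class G = comb_prod t.
Proof.
move=> Qs QG; have Qp := polytopeP Q; have [_ _ [I [a [b QE]]]] := Qp.
have self (F : polytope R n) : nfaces F F.
  by split; [exact: faces_self|case: (polytopeP F)].
pose act (F : set 'rV[R]_n) : {set I} :=
  finset (fun i => `[< forall x, F x -> dotp (a i) x = b i >]).
have actE F : nfaces Q F ->
    F = Q `&` [set x | forall i, i \in act F -> dotp (a i) x = b i].
  move=> QF; have FQ := faces_sub QF.1; apply/seteqP; split=> [x Fx|x [Qx /= H]].
    by split=> [|i /=]; [exact: FQ|rewrite finset.inE => /asboolP; apply].
  have [J FE] := nfaces_active QE QF; rewrite FE; split=> //= i iJ.
  by apply: H; rewrite finset.inE; apply/asboolP => y; rewrite FE => -[_]; apply.
have act_inj F H : nfaces Q F -> nfaces Q H -> act F = act H -> F = H.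
  by move=> QF QH E; rewrite [LHS](actE _ QF) [RHS](actE _ QH) E.
have actS F F' : F `<=` F' -> act F' \subset act F.
  move=> FF; apply/fintype.subsetP => i; rewrite !finset.inE => /asboolP H.
  by apply/asboolP => x /FF; exact: H.
have climb (F : polytope R n) : nfaces Q F -> G `<=` F -> G <> F :> set _ ->
    exists F' : polytope R n, [/\ facets F F', G `<=` F' & act F != act F'].
  move=> QF GF GneF.
  (* Among the proper faces of [F] containing [G], one with the fewest active inequalities is a
     facet: a larger face has no further active inequalities, and faces with equal active sets are
     equal. *)
  pose p k := `[< exists F' : polytope R n,
    [/\ nfaces F F', F' <> F :> set _, G `<=` F' & k = #|act F'|] >].
  have FG : nfaces F G by apply/(nface_trans _ Qp QF).
  have ex : exists k, p k by exists #|act G|; apply/asboolP; exists G; split.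
  case: (ex_minnP ex) => _ /asboolP[F' [FF' F'F GF' ->]] min.
  have QF' := (nface_trans _ Qp QF).1 FF'.
  exists F'; split=> //; last first.
    by apply/eqP => E; apply: F'F; apply: act_inj => //; case: QF'.
  apply/facetsP; split=> // H FH F'H; have [->|HF] := pselect (H = F); first by right.
  left; pose H' := Polytope (nface_polytope (polytopeP F) FH).
  have QH := (nface_trans _ Qp QF).1 FH.
  have /min le : p #|act H|.
    by apply/asboolP; exists H'; split=> //; exact: subset_trans GF' F'H.
  have /eqP E : act H == act F' by rewrite eqEcard le actS.
  by apply: act_inj => //; [case: QH|case: QF'].
pose q k := `[< exists F : polytope R n, [/\ nfaces Q F, G `<=` F,
  exists t, comb_class F = comb_prod t & k = #|act F|] >].
have ex : exists k, q k.
  by exists #|act Q|; apply/asboolP; exists Q; split=> //; [exact: faces_sub QG.1|exists s].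
have bound k : q k -> (k <= #|I|)%N.
  by move=> /asboolP[F [_ _ _ ->]]; exact: max_card.
(* A face with the most active inequalities has to be [G]: otherwise [climb] yields a facet of it,
   whose class is again a monomial, with strictly more of them. *)
case: (ex_maxnP ex bound) => _ /asboolP[F [QF GF [t Ft] ->]] max.
have [GeF|GneF] := pselect (G = F :> set _).
  by exists t; rewrite (polytope_inj GeF).
have [F' [FF' GF' ne]] := climb F QF GF GneF.
have /facetsP[nF' _ _] := FF'; have [QF' F'F] := (nface_trans _ Qp QF).1 nF'.
have /max le : q #|act F'|.
  by apply/asboolP; exists F'; split=> //; exact: facet_comb_prod Ft FF'.
by case/eqP: ne; apply/eqP; rewrite eqEcard le actS.
Qed.

End Monomials.

(** * Numbers of vertices under combinatorial equivalence and products *)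

Section Vertices.
Variable R : realType.

Definition vertices n (P : set 'rV[R]_n) : set 'rV[R]_n :=
  [set v | faces P [set v]].

Definition nb_vertices n (P : set 'rV[R]_n) (m : nat) : Prop :=
  exists s : seq 'rV[R]_n, [/\ uniq s, vertices P = [set` s] & size s = m].

Lemma nb_vertices_inj n (P : set 'rV[R]_n) m k :
  nb_vertices P m -> nb_vertices P k -> m = k.
Proof.
move=> [s [us Ps <-]] [t [ut Pt <-]]; apply: perm_size; apply: uniq_perm => // x.
have : [set` s] x = [set` t] x by rewrite -Ps Pt.
by rewrite /= => E; apply/idP/idP; rewrite E.
Qed.

Lemma sub_vertices_size n (P : set 'rV[R]_n) m (t : seq 'rV[R]_n) :
  nb_vertices P m -> uniq t -> [set` t] `<=` vertices P -> (size t <= m)%N.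
Proof.
move=> [s [us Ps <-]] ut tP; apply: uniq_leq_size => // x /tP.
by rewrite Ps.
Qed.

Lemma vertices_nface n (P : set 'rV[R]_n) v : vertices P v -> nfaces P [set v].
Proof. by split=> //; exists v. Qed.

Lemma nb_vertices_exists n (P : polytope R n) : exists m, nb_vertices P m.
Proof.
have [_ _ [I [a [b PE]]]] := polytopeP P.
pose h (J : {set I}) :=
  polytope_set P `&` [set x | forall i, i \in J -> dotp (a i) x = b i].
have fin : finite_set (vertices P).
  apply: (@sub_finite_set _ _ (set1 @^-1` (h @` [set: {set I}]))).
    by move=> v /vertices_nface/(nfaces_active PE)[J /= ->]; exists J.
  apply: finite_preimage; last exact/finite_image/finite_finset.
  by move=> u v _ _ E; have : [set u] v by rewrite E.
exists (size (finmap.enum_fset (fset_set (vertices P)))).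
exists (finmap.enum_fset (fset_set (vertices P))); split=> //.
  by rewrite finmap.fset_uniq.
by apply/seteqP; split=> v /=; rewrite in_fset_set ?inE.
Qed.

Lemma dotp_continuous n (a : 'rV[R]_n) : continuous (dotp a).
Proof.
have mul_coord j (x : 'rV[R]_n) :
    {for x, continuous (fun x : 'rV[R]_n => a 0 j * x 0 j : R)}.
  refine (continuousM (_ : {for x, continuous (fun=> a 0 j)}) _).
    exact: cst_continuous.
  exact: coord_continuous.
rewrite /dotp; elim: (index_enum _) => [|j s IH] x.
  by under eq_fun do rewrite big_nil; exact: cst_continuous.
under eq_fun do rewrite big_cons.
exact: continuousD (mul_coord j x) (IH x).
Qed.

Lemma polytope_closed n (P : set 'rV[R]_n) : is_polytope P -> closed P.
Proof.
move=> [_ _ [I [a [b ->]]]].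
have -> : [set x | forall i, dotp (a i) x <= b i] =
    \bigcap_(i in [set: I]) [set x | dotp (a i) x <= b i].
  by apply/seteqP; split=> [x H i _|x H i]; exact: H.
apply: closed_bigI => i _.
have /continuous_closedP/(_ _ (@closed_le R (b i))) := @dotp_continuous n (a i).
exact.
Qed.

(** By compactness each coordinate attains a maximum on [F]; the face where it does is all of [F],
    so every coordinate is constant. This describes vertices in terms of the order on faces
    alone. *)
Lemma minimal_nface n (F : set 'rV[R]_n) : is_polytope F ->
  (forall G, nfaces F G -> G = F) -> exists v, F = [set v].
Proof.
move=> Fp min; have [[v Fv] Fb _] := Fp.
exists v; apply/seteqP; split=> [w Fw /=|_ -> //].
apply/rowP => i.
suff le x y : F x -> F y -> x 0 i <= y 0 i by apply/eqP; rewrite eq_le !le.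
move=> Fx Fy.
have [|z Fz zmax] := @EVT_max_rV R n (fun x => x 0 i) F (ex_intro _ v Fv)
    (bounded_closed_compact Fb (polytope_closed Fp)).
  by apply: continuous_subspaceT => u; exact: coord_continuous.
have dE (u : 'rV[R]_n) : dotp (delta_mx 0 i) u = u 0 i.
  rewrite /dotp (bigD1 i) //= mxE !eqxx mul1r big1 ?addr0 // => j ji.
  by rewrite mxE (negbTE ji) mul0r.
have FG : nfaces F (F `&` [set u | dotp (delta_mx 0 i) u = z 0 i]).
  split; last by exists z; split; [exact: set_mem|rewrite /= dE].
  by exists (delta_mx 0 i), (z 0 i); split=> // u Fu /=; rewrite dE zmax // inE.
have /min E := FG; move: Fx Fy; rewrite -E => -[_ /=]; rewrite dE => ->.
by case=> _ /=; rewrite dE => ->.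
Qed.

(** Vertices are the minimal nonempty faces, so an isomorphism of face posets matches them. *)
Lemma comb_ne_nb_vertices n m (P : polytope R n) (Q : polytope R m) k :
  comb_ne P Q -> nb_vertices P k -> nb_vertices Q k.
Proof.
move=> [f [g [fP gP fm gm]]] [s [us Ps <-]].
have [Pp Qp] := (polytopeP P, polytopeP Q).
have Pv v : vertices P v <-> v \in s by rewrite Ps.
have sing n' (v : 'rV[R]_n') G : G !=set0 -> G `<=` [set v] -> G = [set v].
  by move=> [w Gw] GS; apply/seteqP; split=> // _ ->; rewrite -(GS w Gw).
have Qf v : vertices P v -> exists w, vertices Q w /\ f [set v] = [set w].
  move=> /vertices_nface Pv'; have [Qf gf] := fP _ Pv'.
  suff [w E] : exists w, f [set v] = [set w].
    by exists w; rewrite /vertices /= -E; case: Qf.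
  apply: minimal_nface => [|G]; first exact: nface_polytope Qf.
  move=> /(nface_trans _ Qp Qf)[QG GS]; have [Pg fg] := gP _ QG.
  rewrite -fg; congr f; apply: sing; first by case: Pg.
  by rewrite -gf; exact: gm.
have Pg w : vertices Q w -> exists v, vertices P v /\ g [set w] = [set v].
  move=> /vertices_nface Qw; have [Pg fg] := gP _ Qw.
  suff [v E] : exists v, g [set w] = [set v].
    by exists v; rewrite /vertices /= -E; case: Pg.
  apply: minimal_nface => [|G]; first exact: nface_polytope Pg.
  move=> /(nface_trans _ Pp Pg)[PG GS]; have [Qf' gf] := fP _ PG.
  rewrite -gf; congr g; apply: sing; first by case: Qf'.
  by rewrite -fg; exact: fm.
have /choice[h hP] (v : 'rV[R]_n) :
    exists w, vertices P v -> vertices Q w /\ f [set v] = [set w].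
  by have [/Qf[w wP]|nv] := pselect (vertices P v); [exists w|exists 0].
exists (map h s); split; last by rewrite size_map.
- rewrite map_inj_in_uniq // => v w /Pv vs /Pv ws E.
  have /vertices_nface/fP[_ gv] := vs; have /vertices_nface/fP[_ gw] := ws.
  have : [set w] v by rewrite -gw (hP w ws).2 -E -(hP v vs).2 gv.
  by [].
- apply/seteqP; split=> w /=.
    move=> Qw; have [v [vP gv]] := Pg w Qw.
    apply/mapP; exists v; first exact/Pv.
    have [_ fg] := gP _ (vertices_nface Qw).
    have : [set h v] w by rewrite -(hP v vP).2 -gv fg.
    by [].
  by move=> /mapP[v /Pv /hP[? _] ->].
Qed.

Lemma nb_vertices_prod n m (P : set 'rV[R]_n) (Q : set 'rV[R]_m) k l :
  nb_vertices P k -> nb_vertices Q l -> nb_vertices (prod_set P Q) (k * l).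
Proof.
move=> [s [us Ps <-]] [t [ut Qt <-]].
exists [seq row_mx v w | v <- s, w <- t]; split; last by rewrite size_allpairs.
- apply: allpairs_uniq => // -[v w] [v' w'] _ _ /= E.
  by have [-> ->] := eq_row_mx E.
- have Pv v : vertices P v <-> v \in s by rewrite Ps.
  have Qw w : vertices Q w <-> w \in t by rewrite Qt.
  have p1 (v : 'rV[R]_n) (w : 'rV[R]_m) : prod_set [set v] [set w] = [set row_mx v w].
    apply/seteqP; split=> [x [/= <- <-]|_ /= ->]; first by rewrite hsubmxK.
    by split; rewrite ?row_mxKl ?row_mxKr.
  apply/seteqP; split=> [x /vertices_nface/nfaces_prodP[Pl Qr E]|_ /allpairsP[[v w] /= [/Pv vP /Qw wQ ->]]].
    have lE : lset [set x] = [set lsubmx x].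
      by apply/seteqP; split=> [_ [_ -> <-]//|_ ->]; exists x.
    have rE : rset [set x] = [set rsubmx x].
      by apply/seteqP; split=> [_ [_ -> <-]//|_ ->]; exists x.
    apply/allpairsP; exists (lsubmx x, rsubmx x); rewrite hsubmxK /=; split=> //.
      by apply/Pv; rewrite /vertices /= -lE; case: Pl.
    by apply/Qw; rewrite /vertices /= -rE; case: Qr.
  rewrite /vertices /= -p1.
  by case: (nfaces_prod (vertices_nface vP) (vertices_nface wQ)).
Qed.

Lemma nb_vertices_point : nb_vertices [set: 'rV[R]_0] 1.
Proof.
exists [:: 0]; split=> //; apply/seteqP; split=> v /=.
  by rewrite inE => _; apply/eqP/rowP => -[].
rewrite inE => /eqP ->; rewrite /vertices /=.
have -> : [set 0] = [set: 'rV[R]_0]; last exact: faces_self.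
by apply/seteqP; split=> // w _; apply/rowP => -[].
Qed.

Lemma comb_class_nb_vertices n m (P : polytope R n) (Q : polytope R m) k :
  comb_class P = comb_class Q -> nb_vertices P k -> nb_vertices Q k.
Proof. by move=> /comb_classP/comb_equivP; exact: comb_ne_nb_vertices. Qed.

(** [Phi] stands for any property of numbers stable under products; the empty monomial is the point,
    whose single vertex accounts for [Phi 1]. *)
Lemma comb_prod_nb_vertices (Phi : nat -> Prop) (d : nat -> nat)
    (P : forall k, polytope R (d k)) :
  Phi 1%N -> (forall i j, Phi i -> Phi j -> Phi (i * j)%N) ->
  (forall k m, nb_vertices (P k) m -> Phi m) ->
  forall n (Q : polytope R n) s m,
    comb_class Q = comb_prod (fun k => comb_class (P k)) s ->
    nb_vertices Q m -> Phi m.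
Proof.
move=> Phi1 PhiM PhiP n Q s; elim: s n Q => [|k s IH] n Q m /= QE Qm.
  by rewrite (nb_vertices_inj (comb_class_nb_vertices QE Qm) nb_vertices_point).
have [i Pi] := nb_vertices_exists (P k).
move: QE; rewrite -(comb_classE (comb_prod _ s)) comb_mulE.
set T := tagged _ => QE; have [j Tj] := nb_vertices_exists T.
have /nb_vertices_inj/(_ (nb_vertices_prod Pi Tj)) -> := comb_class_nb_vertices QE Qm.
by apply: PhiM; [exact: PhiP Pi|apply: IH Tj; exact: comb_classE].
Qed.

End Vertices.

(** * Orderings of connected vertex sets *)

Lemma connect_exit (T : finType) (r : rel T) (A : {pred T}) x y :
  connect r x y -> x \in A -> y \notin A ->
  exists u v, [/\ u \in A, v \notin A & r u v].
Proof.
move=> /connectP[p]; elim: p x => [|z p IH] x /=; first by move=> _ -> ->.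
move=> /andP[xz zp] yE xA yA; have [zA|zA] := boolP (z \in A); first exact: (IH z).
by exists x, z.
Qed.

Section ConnectedOrders.
Variables (T : finType) (e : rel T).

(* Orderings are listed from the last vertex to the first. *)
Fixpoint conn_order (s : seq T) : bool :=
  if s is v :: l then [&& v \notin l, nilp l || has (e v) l & conn_order l]
  else true.

Lemma conn_order_uniq s : conn_order s -> uniq s.
Proof. by elim: s => //= v l IH /and3P[-> _ /IH]. Qed.

Lemma conn_order_catr t s : conn_order (t ++ s) -> conn_order s.
Proof. by elim: t => //= v t IH /and3P[_ _ /IH]. Qed.

Lemma conn_order_cons v l :
  v \notin l -> has (e v) l -> conn_order l -> conn_order (v :: l).
Proof. by move=> /= -> -> ->; rewrite orbT. Qed.

Hypothesis esym : symmetric e.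

Lemma conn_order_building s :
  conn_order s -> ~~ nilp s -> building e [set x in s]%SET.
Proof.
elim: s => //= v l IH /and3P[vl /orP vE cl] _; apply/andP; split.
  by apply/finset.set0Pn; exists v; rewrite !finset.inE eqxx.
pose r (S : {set T}) := [rel u w | [&& u \in S, w \in S & e u w]].
have rsym (S : {set T}) : connect_sym (r S).
  by apply: sym_connect_sym => x y /=; rewrite andbCA esym.
suff [u H] : exists u, forall x, x \in v :: l ->
    connect (r [set x in v :: l]%SET) x u.
  apply/forall_inP => x; rewrite finset.inE => xs.
  apply/forall_inP => y; rewrite finset.inE => ys.
  by apply: connect_trans (H x xs) _; rewrite rsym; exact: H.
case: vE => [/nilP ->|/hasP[u ul vu]].
  by exists v => x; rewrite inE => /eqP ->.
exists u => x; rewrite inE => /orP[/eqP ->|xl].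
  by apply: connect1; rewrite /= !finset.inE eqxx ul orbT.
have /andP[_ /forall_inP H] : building e [set x in l]%SET.
  by apply: IH => //; case: (l) ul.
have /H/forall_inP/(_ u) : x \in [set x in l]%SET by rewrite finset.inE.
rewrite finset.inE => /(_ ul); apply: connect_sub => y z /=.
rewrite !finset.inE => /and3P[yl zl yz].
by apply: connect1; rewrite /= !finset.inE yl zl yz !orbT.
Qed.

Lemma building_exit (S : {set T}) (A : seq T) : building e S ->
  ~~ nilp A -> {subset A <= S} -> (exists2 x, x \in S & x \notin A) ->
  exists u v, [/\ u \in A, v \in S, v \notin A & e v u].
Proof.
move=> /andP[_ /forall_inP H]; case: A => // x A _ AS [y yS yA].
have xA : x \in x :: A by rewrite inE eqxx.
have /H/forall_inP/(_ y yS) c := AS _ xA.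
have [u [v [uA vA /= /and3P[_ vS uv]]]] := connect_exit c xA yA.
by exists u, v; rewrite esym.
Qed.

(** Connectedness supplies a vertex of [S] adjacent to the part listed so far; the induction is on
    the number of vertices still missing. *)
Lemma conn_order_extend (S : {set T}) m : building e S ->
  conn_order m -> ~~ nilp m -> {subset m <= S} ->
  exists t, conn_order (t ++ m) /\ t ++ m =i S.
Proof.
move=> BS; move: {2}(#|S| - size m)%N (erefl (#|S| - size m)%N) => k.
elim: k m => [|k IH] m kE cm m0 mS.
  exists [::]; split=> // x; have /= mE := card_uniqP (conn_order_uniq cm).
  have sub : m \subset S by apply/fintype.subsetP.
  have /subset_leqif_card[le E] := sub.
  apply/(subset_cardP _ sub); apply/eqP; rewrite eqn_leq le mE.
  by rewrite -subn_eq0 kE.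
have [x xS xm] : exists2 x, x \in S & x \notin m.
  apply/exists_inP; rewrite -[X in is_true X]negbK negb_exists_in.
  apply/negP => /forall_inP H.
  have : (#|S| <= #|m|)%N.
    by apply/subset_leq_card/fintype.subsetP => x /H; rewrite negbK.
  rewrite (card_uniqP (conn_order_uniq cm)) -subn_eq0 kE //.
have [u [v [um vS vm vu]]] := building_exit BS m0 mS (ex_intro2 _ _ x xS xm).
have cvm : conn_order (v :: m).
  by rewrite /= vm cm andbT /=; apply/orP; right; apply/hasP; exists u.
have vmS : {subset v :: m <= S} by move=> w; rewrite inE => /orP[/eqP ->|/mS].
have [|t [ct tE]] := IH (v :: m) _ cvm isT vmS; first by rewrite /= subnS kE.
by exists (rcons t v); rewrite cat_rcons.
Qed.

(** An ordering of [S] that starts from [r] ends in some [v] other than [r], and the vertices before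
    [v] form a connected set. *)
Lemma building_remove (S : {set T}) r : building e S -> (1 < #|S|)%N ->
  r \in S -> exists v, [/\ v \in S, v != r & building e (S :\ v)%SET].
Proof.
move=> BS S1 rS.
have rS' : {subset [:: r] <= S} by move=> x; rewrite inE => /eqP ->.
have [//|t [ct tE]] := conn_order_extend BS (m := [:: r]) _ isT rS'.
case: t ct tE => [|v t] /= ct tE.
  by move: S1; rewrite -(eq_card tE) (card_uniqP _).
have /and3P[vt _ ct'] := ct; exists v; split.
- by rewrite -tE inE eqxx.
- by apply: contraNneq vt => ->; rewrite mem_cat inE eqxx orbT.
rewrite (_ : (S :\ v)%SET = [set x in t ++ [:: r]]%SET).
  by apply: conn_order_building => //; case: (t).
apply/finset.setP => x; rewrite !finset.inE -tE inE -/(x \in _).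
by have [->|] := eqVneq x v; rewrite ?(negbTE vt) ?orbF.
Qed.

(* A connected set has at least two vertices whose removal leaves it
   connected, so the number of orderings at least doubles with each vertex. *)
Lemma many_conn_orders k (S : {set T}) : building e S -> #|S| = k.+1 ->
  exists L : seq (seq T), [/\ uniq L, size L = (2 ^ k)%N &
    forall l, l \in L -> conn_order l /\ l =i S].
Proof.
elim: k S => [|k IH] S BS Sk.
  have /eqP/cards1P[x ->] := Sk; exists [:: [:: x]]; split=> // l.
  by rewrite inE => /eqP ->; split=> // y; rewrite !inE.
have S1 : (1 < #|S|)%N by rewrite Sk.
have /andP[/finset.set0Pn[r rS] _] := BS.
have [v [vS _ Bv]] := building_remove BS S1 rS.
have [w [wS wv Bw]] := building_remove BS S1 vS.
have card x : x \in S -> #|(S :\ x)%SET| = k.+1.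
  by move=> xS; have := cardsD1 x S; rewrite xS Sk add1n => -[].
have [Lv [uLv sLv cLv]] := IH _ Bv (card v vS).
have [Lw [uLw sLw cLw]] := IH _ Bw (card w wS).
have cons_order x l : x \in S -> conn_order l -> l =i (S :\ x)%SET ->
    conn_order (x :: l) /\ x :: l =i S.
  move=> xS cl lE; have xl : x \notin l by rewrite lE !finset.inE eqxx.
  split=> [|y]; last first.
    by rewrite inE lE !finset.inE; case: eqVneq => // ->.
  have l0 : ~~ nilp l.
    rewrite /nilp -(card_uniqP (conn_order_uniq cl)) (eq_card lE) (card x xS) //.
  have lS : {subset l <= S} by move=> y; rewrite lE !finset.inE => /andP[].
  have [u [y [ul yS yl yu]]] := building_exit BS l0 lS (ex_intro2 _ _ x xS xl).
  have -> /= : x = y.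
    by apply/eqP; move: yl; rewrite lE !finset.inE yS andbT negbK eq_sym.
  by rewrite yl cl andbT; apply/orP; right; apply/hasP; exists u.
exists (map (cons v) Lv ++ map (cons w) Lw); split.
- rewrite cat_uniq !map_inj_uniq ?uLv ?uLw; try by move=> ? ? [].
  rewrite andbT /=; apply/hasPn => _ /mapP[l _ ->]; apply/mapP => -[l' _ [E _]].
  by move/eqP: wv.
- by rewrite size_cat !size_map sLv sLw addnn -mul2n expnS.
- move=> l; rewrite mem_cat => /orP[] /mapP[l' /[dup] l'L + ->].
    by move=> /cLv[]; exact: cons_order.
  by move=> /cLw[]; exact: cons_order.
Qed.

End ConnectedOrders.

Lemma conn_order_complete (T : finType) (e : rel T) s :
  (forall x y, e x y = (x != y)) -> uniq s -> conn_order e s.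
Proof.
move=> eE; elim: s => //= v l IH /andP[vl ul]; rewrite vl IH //= andbT.
case: l vl {IH ul} => //= w l; rewrite inE negb_or => /andP[vw _].
by rewrite eE vw.
Qed.

Lemma perm_eq3 (T : eqType) (a b c : T) :
  [/\ perm_eq [:: c; a; b] [:: c; b; a], perm_eq [:: b; c; a] [:: c; b; a],
      perm_eq [:: b; a; c] [:: c; b; a], perm_eq [:: a; c; b] [:: c; b; a] &
      perm_eq [:: a; b; c] [:: c; b; a]].
Proof. by split; apply/seq.permP => p /=; lia. Qed.

(** * Induced paths and triangle minors *)

Section ConnectedGraph.
Variables (T : finType) (e : rel T).
Hypothesis econn : connected_graph e.

Let esym : symmetric e. Proof. by case: econn. Qed.
Let eirr : irreflexive e. Proof. by case: econn. Qed.

Lemma connected_building (x : T) : building e [set: T]%SET.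
Proof.
apply/andP; split; first by apply/finset.set0Pn; exists x; rewrite finset.inE.
apply/forall_inP => y _; apply/forall_inP => z _.
have [_ _ /(_ y z)] := econn; apply: connect_sub => u v uv.
by apply: connect1; rewrite /= !finset.inE.
Qed.

Lemma conn_order_full m : conn_order e m -> ~~ nilp m ->
  exists t, conn_order e (t ++ m) /\ forall x, x \in t ++ m.
Proof.
move=> cm; case: m cm => // x m cm m0.
have [|t [ct tE]] := conn_order_extend esym (connected_building x) cm m0.
  by move=> y _; rewrite finset.inE.
by exists t; split=> // y; rewrite tE finset.inE.
Qed.

(** A walk from [x] to [y] has to leave the closed neighbourhood of [x]; the edge by which it leaves
    provides [b] and [c]. *)
Lemma not_complete_induced_path : (exists x y, (x != y) && ~~ e x y) ->
  exists a b c, [/\ e a b, e b c, a != c & ~~ e a c].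
Proof.
move=> [x [y /andP[xy nxy]]]; have [_ _ /(_ x y) c] := econn.
have [||u [v []]] := connect_exit (A := [pred z | (z == x) || e x z]) c.
- by rewrite inE eqxx.
- by rewrite inE negb_or eq_sym xy.
rewrite !inE negb_or => uA /andP[vx nxv] uv; exists x, u, v; split=> //.
- by case/orP: uA => // /eqP ux; rewrite ux in uv; rewrite uv in nxv.
- by rewrite eq_sym.
Qed.

(* Contracting [D] turns [a], [b], [c] into a triangle. *)
Definition triangle_minor (D : seq T) a b c : Prop :=
  [/\ conn_order e D, ~~ nilp D, uniq [:: c, b, a & D],
      has (e a) D && has (e c) D & has (e b) D || e b a && e b c].

Lemma triangle_minor_conn_order D a b c :
  triangle_minor D a b c -> conn_order e [:: c, b, a & D].
Proof.
move=> [cD _ /and4P[cbaD baD aD _] /andP[ha hc] hb].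
do 2?[apply: conn_order_cons => //]; rewrite ?conn_order_cons //=.
- by rewrite hc !orbT.
- by case/orP: hb => [->|/andP[-> _]]; rewrite ?orbT.
Qed.

Fixpoint induced_path (s : seq T) : bool :=
  if s is v :: l then
    (if l is u :: l' then e v u && ~~ has (e v) l' else true) && induced_path l
  else true.

Lemma induced_path3 a b c : e a b -> e b c -> a != c -> ~~ e a c ->
  conn_order e [:: c; b; a] /\ induced_path [:: c; b; a].
Proof.
move=> ab bc ac nac.
have ba : b != a by apply: contraTneq ab => ->; rewrite eirr.
have cb : c != b by apply: contraTneq bc => ->; rewrite eirr.
rewrite /= !inE negb_or cb [c == a]eq_sym ac ba !orbF !andbT.
by rewrite [e c b]esym bc [e b a]esym ab [e c a]esym nac.
Qed.

Lemma induced_path_nth x0 s i j : induced_path s ->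
  (i < j < size s)%N -> e (nth x0 s i) (nth x0 s j) = (j == i.+1).
Proof.
elim: s i j => [|v l IH] i j /=; first by rewrite ltn0 andbF.
move=> /andP[vl lp]; case: j => [|j]; first by rewrite ltn0.
case: i => [|i]; last by move=> ij; rewrite IH.
move=> /= jl; rewrite eqSS; case: l vl jl {IH lp} => //= u l /andP[vu /hasPn vl].
case: j => [|j] //= jl; rewrite ?vu //; apply/negbTE/vl.
exact: mem_nth.
Qed.

Lemma induced_path_last u p w q :
  induced_path (u :: p ++ w :: q) -> e (last u p) w.
Proof.
elim: p u => [|z p IH] u /=; first by case/andP => /andP[].
by move=> /andP[_] /IH.
Qed.

(** Without a triangle minor all degrees are at most 2 and some vertex has at most one neighbour; an
    ordering grown from that vertex can only be prolonged at its end. *)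
Lemma triangle_minor_or_path : (3 < #|T|)%N ->
  (exists D a b c, triangle_minor D a b c) \/
  exists s, [/\ uniq s, forall x, x \in s & induced_path s].
Proof.
move=> T3.
have [|no] := pselect (exists D a b c, triangle_minor D a b c); [by left|right].
(* A vertex with three neighbours is itself a set to contract. *)
have deg2 v a b c : e v a -> e v b -> e v c -> uniq [:: c; b; a] -> False.
  move=> va vb vc u; apply: no; exists [:: v], a, b, c.
  split=> //; rewrite /= ?orbF 1?[e a v]esym 1?[e c v]esym 1?[e b v]esym ?va ?vb ?vc //.
  have := u; rewrite /= !inE !negb_or -!andbA !andbT => /and3P[-> -> ->] /=.
  apply/and3P; split; apply/eqP => E.
  - by rewrite E eirr in vc.
  - by rewrite E eirr in vb.
  - by rewrite E eirr in va.
have [x0 _] : exists x : T, x \in T by apply/card_gt0P; apply: leq_trans T3.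
(* If every vertex had two neighbours, the last three vertices [a], [b], [c] of an ordering would
   give a triangle minor or a vertex of degree 3: one of them without a neighbour among the
   remaining vertices [D] is adjacent to the other two. *)
have [r leaf] : exists r, forall u w, e r u -> e r w -> u = w.
  apply: contrapT => noleaf.
  have two r : exists u w, [/\ e r u, e r w & u != w].
    apply: contrapT => no2; apply: noleaf; exists r => u w ru rw.
    by apply/eqP/negPn/negP => uw; apply: no2; exists u, w.
  have [//|t [ct tfull]] := conn_order_full (m := [:: x0]) isT.
  move: (t ++ _) ct tfull => s cs sfull {t}.
  have sz : size s = #|T|.
    rewrite -(card_uniqP (conn_order_uniq cs)); apply: eq_card => x.
    by rewrite sfull.
  case: s cs sfull sz => [|c [|b [|a D]]] cs sfull sz; try by rewrite -sz in T3.
  have D0 : ~~ nilp D by case: (D) sz => // sz; rewrite -sz in T3.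
  have u3 := conn_order_uniq cs.
  have cD : conn_order e D := conn_order_catr (t := [:: c; b; a]) cs.
  have da : has (e a) D.
    by case/and3P: cs => _ _ /and3P[_ _ /and3P[_]]; rewrite (negbTE D0).
  have nb x y : ~~ has (e x) D -> e x y -> y \in [:: c; b; a].
    move=> /hasPn xD xy; have := sfull y.
    rewrite -[[:: c, b, a & D]]/([:: c; b; a] ++ D) mem_cat => /orP[//|/xD].
    by rewrite xy.
  have both x y z : perm_eq [:: x; y; z] [:: c; b; a] -> ~~ has (e x) D ->
      e x y && e x z.
    move=> p xD; have [u [w [xu xw uw]]] := two x.
    have := nb _ _ xD xu; have := nb _ _ xD xw; rewrite -!(perm_mem p) !inE.
    have [E|_] := eqVneq w x; first by rewrite E eirr in xw.
    have [E|_] := eqVneq u x; first by rewrite E eirr in xu.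
    move=> /= /orP[]/eqP E1 /orP[]/eqP E2; subst; rewrite ?eqxx // in uw *.
      by rewrite xu xw.
    by rewrite xu xw.
  have [dc|dc] := boolP (has (e c) D).
    apply: no; exists D, a, b, c; split=> //; first by rewrite da.
    have [//|db /=] := boolP (has (e b) D).
    by apply: both db; case: (perm_eq3 a b c).
  have ca_cb := both c b a (perm_refl _) dc.
  have [db|db] := boolP (has (e b) D).
    (* Here [c], adjacent to [a] and [b] but not to [D], takes the role of the middle vertex. *)
    apply: no; exists D, a, c, b.
    split=> //; rewrite ?da //; last by rewrite andbC ca_cb orbT.
    have p3 : perm_eq ([:: b; c; a] ++ D) ([:: c; b; a] ++ D).
      by rewrite perm_cat2r; case: (perm_eq3 a b c).
    by rewrite (perm_uniq p3).
  have /andP[bc ba] : e b c && e b a.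
    by apply: both db; case: (perm_eq3 a b c).
  have /andP[cb ca] := ca_cb; have /hasP[d dD ad] := da.
  apply: (deg2 a d b c) => //; [by rewrite esym|by rewrite esym|].
  move: u3 => /=; rewrite !inE !negb_or => /and4P[/and3P[cb' _ cD'] /andP[_ bD] _ _].
  by rewrite cb' andbT /=; apply/andP; split; apply/eqP => E; subst d;
    [rewrite dD in cD'|rewrite dD in bD].
have [//|t [ct tfull]] := conn_order_full (m := [:: r]) isT.
exists (t ++ [:: r]); split=> //; first exact: conn_order_uniq ct.
elim: t ct {tfull} => // v l IH; rewrite cat_cons => ct.
have uq := conn_order_uniq ct; have /and3P[vl vE /IH ip {IH}] := ct.
rewrite /= ip andbT.
have lr : last v (l ++ [:: r]) = r by rewrite last_cat.
case: (l ++ _) lr vl vE uq ip => [//|u m] /= lr vm vE uq ip.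
(* A neighbour [w] of [v] further along the path would have three neighbours, namely [v] and the two
   next to it on the path; if [w] is the end [r], it would have two. *)
have nv : ~~ has (e v) m.
  apply/hasPn => w wm; apply/negP => vw.
  case/splitPr: wm lr vm uq ip {vE} => p q lr vm uq ip.
  have pw := induced_path_last ip.
  have vp : v != last u p.
    by apply: contraNneq vm => ->; rewrite -cat_cons mem_cat mem_last.
  case: q lr vm uq ip => [|z q] lr vm uq ip.
    move: lr; rewrite last_cat /= => wr; subst w.
    by move: vp; rewrite (leaf v (last u p)) ?eqxx // esym.
  have wz : e w z.
    suff : induced_path (w :: z :: q) by case/andP => /andP[].
    by elim: (p) (u) ip => [|y p' IHp] x /andP[_] //=; exact: IHp.
  apply: (deg2 w v (last u p) z) => //; try by rewrite esym.
  have zs : z \notin u :: p.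
    have : uniq ((u :: p) ++ [:: w, z & q]) by case/andP: uq.
    by rewrite cat_uniq => /and3P[_ /hasPn/(_ z) H _]; apply: H; rewrite !inE eqxx orbT.
  rewrite /= !inE negb_or ![_ == v]eq_sym vp !andbT.
  apply/andP; split; last first.
    by apply: contraNneq vm => ->; rewrite inE mem_cat !inE eqxx !orbT.
  by apply: contraNneq zs => ->; exact: mem_last.
by case/orP: vE => [->|hv]; rewrite ?nv // hv in nv.
Qed.

End ConnectedGraph.

(** * Faces and vertices of graph-associahedra in coordinates *)

Lemma faces_setI (R : realType) n (P F G : set 'rV[R]_n) :
  faces P F -> faces P G -> faces P (F `&` G).
Proof.
move=> [a [c [Pa ->]]] [b [d [Pb ->]]]; exists (a + b), (c + d).
have dE x : dotp (a + b) x = dotp a x + dotp b x.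
  by rewrite /dotp -big_split; apply: eq_bigr => i _; rewrite mxE mulrDl.
split=> [x Px /=|]; first by rewrite dE lerD ?Pa ?Pb.
apply/seteqP; split=> [x [[Px /= ax] [_ /= bx]]|x [Px /=]].
  by split=> //=; rewrite dE ax bx.
rewrite dE => E; have ax := Pa x Px; have bx := Pb x Px; rewrite /= in ax bx.
by split; split=> //=; lra.
Qed.

(** The functional exposing a vertex [v] is maximal at [v] only; being maximal at a listed point as
    well, it puts [v] on the list. *)
Lemma nb_vertices_of (R : realType) n (G : set 'rV[R]_n) (L : seq 'rV[R]_n) :
  uniq L -> (forall p, p \in L -> vertices G p) ->
  (forall u x, G x -> exists2 p, p \in L & dotp u x <= dotp u p) ->
  nb_vertices G (size L).
Proof.
move=> uL LG LM; exists L; split=> //; apply/seteqP; split=> v //=; last exact: LG.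
move=> [u [c [Gu E]]]; have [Gv uv] : (G `&` [set x | dotp u x = c]) v by rewrite -E.
have [p pL le] := LM u v Gv; have Gp := faces_sub (LG p pL) (erefl p).
suff : [set v] p by move=> <-.
rewrite E; split=> //=; apply/eqP; rewrite eq_le -[X in _ && (X <= _)]uv le andbT.
exact: Gu.
Qed.

(** The empty suffix is left out: an empty sum is 0 and not [3 ^ 0]. *)
Fixpoint suffixes (T : Type) (s : seq T) : seq (seq T) :=
  if s is v :: l then s :: suffixes l else [::].

Lemma suffixes_cat (T : Type) (t m : seq T) :
  suffixes (t ++ m) = [seq l ++ m | l <- suffixes t] ++ suffixes m.
Proof. by elim: t => //= v t ->. Qed.

Lemma suffixesP (T : eqType) (s l : seq T) : l \in suffixes s ->
  ~~ nilp l /\ exists t, s = t ++ l.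
Proof.
elim: s => //= v s IH; rewrite inE => /orP[/eqP ->|/IH[l0 [t ->]]].
  by split=> //; exists [::].
by split=> //; exists (v :: t).
Qed.

Section Tight.
Variables (R : realType) (T : finType) (e : rel T).
Implicit Types (f g : T -> R) (s t m l : seq T) (L : seq (seq T)).

Definition tight f L : Prop :=
  forall l, l \in L -> \sum_(v <- l) f v = 3 ^+ size l.

Lemma tight_cat f L L' : tight f (L ++ L') <-> tight f L /\ tight f L'.
Proof.
split=> [H|[H H'] l]; last by rewrite mem_cat => /orP[/H|/H'].
by split=> l lL; apply: H; rewrite mem_cat lL ?orbT.
Qed.

Lemma tight_cons f l L :
  tight f (l :: L) <-> \sum_(v <- l) f v = 3 ^+ size l /\ tight f L.
Proof.
split=> [H|[H H'] k]; last by rewrite inE => /orP[/eqP ->|/H'].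
by split=> [|k kL]; apply: H; rewrite inE ?eqxx ?kL ?orbT.
Qed.

(** Consecutive sums differ by a single coordinate, so the coordinates on [t] are determined one
    after the other. *)
Lemma tight_inj f g t m : \sum_(v <- m) f v = \sum_(v <- m) g v ->
  tight f [seq l ++ m | l <- suffixes t] ->
  tight g [seq l ++ m | l <- suffixes t] -> {in t, f =1 g}.
Proof.
move=> fgm; elim: t => // v t IH /= /tight_cons[fv ft] /tight_cons[gv gt].
have fgt := IH ft gt; move=> w; rewrite inE => /orP[/eqP ->|]; last exact: fgt.
have : \sum_(u <- v :: t ++ m) f u = \sum_(u <- v :: t ++ m) g u by rewrite fv gv.
rewrite !big_cons !big_cat /= fgm (eq_big_seq _ fgt); exact: addIr.
Qed.

(** The solution of the equalities for all suffixes: the coordinates are the differences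
    [3 ^ k.+1 - 3 ^ k], except that the earliest vertex receives 3 because the sum before it is
    0. *)
Fixpoint order_point s : T -> R :=
  if s is v :: l then
    fun w => if w == v then (if nilp l then 3 else 2 * 3 ^+ size l)
             else order_point l w
  else fun=> 0.

Lemma order_point_tight s : uniq s -> tight (order_point s) (suffixes s).
Proof.
elim: s => // v s IH /andP[vs us]; have {IH} := IH us => IH.
have eqs : {in s, order_point (v :: s) =1 order_point s}.
  by move=> w ws /=; case: eqVneq vs => // <-; rewrite ws.
apply/tight_cons; split.
  rewrite big_cons (eq_big_seq _ eqs) /= eqxx.
  case: s IH {vs us eqs} => [|w s] /= IH; first by rewrite big_nil addr0.
  by rewrite (IH (w :: s)) ?inE ?eqxx //= [RHS]exprS; lra.
move=> l ls; rewrite -(IH l ls); apply: eq_big_seq => w wl; apply: eqs.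
by have [_ [t ->]] := suffixesP ls; rewrite mem_cat wl orbT.
Qed.

(** Restricting to subsets of [s] allows the inequalities to be checked while vertices are added one
    at a time. *)
Definition feasible f s : Prop := forall S : {set T},
  building e S -> {subset S <= s} -> 3 ^+ #|S| <= \sum_(v in S) f v.

Lemma feasible_ge f s v : feasible f s -> v \in s -> 3 <= f v.
Proof.
move=> fs vs; have := fs _ (building1 e v); rewrite finset.cards1 big_set1 expr1.
by apply=> w; rewrite finset.inE => /eqP ->.
Qed.

(** A set containing [v] either has at most [size s] elements, and then the coordinate at [v]
    suffices, or is all of [v :: s], where equality holds. *)
Lemma feasible_cons f v s : uniq (v :: s) -> feasible f s ->
  3 ^+ size s <= f v -> \sum_(w <- v :: s) f w = 3 ^+ (size s).+1 ->
  feasible f (v :: s).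
Proof.
move=> /= /andP[vs us] fs fv fvs S BS Ss.
have [vS|vS] := boolP (v \in S); last first.
  apply: fs => // w wS; have := Ss w wS; rewrite inE => /orP[/eqP wv|//].
  by rewrite wv (negbTE vS) in wS.
have sub : S \subset v :: s by apply/fintype.subsetP.
have cs : #|v :: s| = (size s).+1 by apply/card_uniqP; rewrite /= vs us.
have [Slt|Sge] := leqP #|S| (size s).
  rewrite (bigD1 v vS) /= (le_trans (_ : _ <= f v)) //.
    by apply: le_trans fv; rewrite ler_weXn2l // ler1n.
  rewrite lerDl sumr_ge0 // => w /andP[/Ss + wv]; rewrite inE (negbTE wv) => ws.
  exact: le_trans (feasible_ge fs ws).
have SE : S =i v :: s.
  by apply/subset_cardP => //; apply/eqP; rewrite eqn_leq cs Sge andbT -cs subset_leq_card.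
by rewrite (eq_card SE) cs -fvs (eq_bigl _ _ SE) -big_uniq //= vs us.
Qed.

Lemma feasible_step f v s : uniq (v :: s) -> feasible f s ->
  nilp s || (\sum_(w <- s) f w == 3 ^+ size s) ->
  \sum_(w <- v :: s) f w = 3 ^+ (size s).+1 -> feasible f (v :: s).
Proof.
move=> uvs fs fss /[dup] fvs; rewrite big_cons exprS => E.
apply: feasible_cons => //; case/orP: fss => [/nilP s0|/eqP fss].
  by move: E; rewrite s0 big_nil expr0; lra.
have : 0 < 3 ^+ size s :> R by rewrite exprn_gt0.
by move: E; rewrite fss; lra.
Qed.

Lemma feasible_cat f t m : uniq (t ++ m) -> feasible f m ->
  nilp m || (\sum_(v <- m) f v == 3 ^+ size m) ->
  tight f [seq l ++ m | l <- suffixes t] -> feasible f (t ++ m).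
Proof.
elim: t => // v t IH utm fm fms /= /tight_cons[fv ft].
apply: feasible_step => //; first by apply: IH => //; case/andP: utm.
case: t ft {IH utm fv} => // w t ft.
by rewrite (ft (w :: t ++ m)) ?eqxx ?orbT // inE eqxx.
Qed.

Lemma feasible_suffixes f s : uniq s -> tight f (suffixes s) -> feasible f s.
Proof.
move=> us fs; rewrite -[s]cats0; apply: feasible_cat; rewrite ?cats0 //.
  move=> S /andP[/finset.set0Pn[x xS] _] S0; by have := S0 x xS.
by rewrite (eq_map (@cats0 T)) map_id.
Qed.

End Tight.

Section Corners.
Variables (R : realType) (n : nat) (e : rel 'I_n.+1).
Hypothesis econn : connected_graph e.

Let esym : symmetric e. Proof. by case: econn. Qed.

Local Notation P := (graph_assoc_set (R := R) e).
Implicit Types (f : 'I_n.+1 -> R) (s t m l : seq 'I_n.+1).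

Lemma size_full s : uniq s -> (forall v, v \in s) -> size s = n.+1.
Proof.
move=> us sfull; rewrite -(card_uniqP us) -[RHS]card_ord; apply: eq_card => v.
by rewrite sfull.
Qed.

Lemma sum_full f s : uniq s -> (forall v, v \in s) ->
  \sum_(v <- s) f v = \sum_v f v.
Proof. by move=> us sfull; rewrite big_uniq //; apply: eq_bigl => v; rewrite sfull. Qed.

Lemma feasible_graph_assoc f s : uniq s -> (forall v, v \in s) ->
  feasible e f s -> \sum_(v <- s) f v = 3 ^+ size s -> P (\row_v f v).
Proof.
move=> us sfull fs fss; split=> [|S BS _].
  by under eq_bigr do rewrite mxE; rewrite -(sum_full f us sfull) fss size_full.
by under eq_bigr do rewrite mxE; apply: fs.
Qed.

Lemma row_fun f : (\row_v f v) 0 = f.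
Proof. by apply/funext => v; rewrite mxE. Qed.

Lemma building_face (S : {set 'I_n.+1}) : building e S ->
  faces P (P `&` [set x | \sum_(i in S) x 0 i = 3 ^+ #|S|]).
Proof.
move=> BS; exists (\row_i - (i \in S)%:R), (- 3 ^+ #|S|).
have dE x : dotp (\row_i - (i \in S)%:R) x = - \sum_(i in S) x 0 i.
  rewrite /dotp [in RHS]big_mkcond -sumrN; apply: eq_bigr => i _; rewrite mxE.
  by case: (i \in S); rewrite ?mulN1r // oppr0 mul0r.
split=> [x [xT xS] /=|].
  (* The full set is not among the inequalities of [P]; for it the defining equation is used. *)
  rewrite dE lerN2; have [ST|ST] := eqVneq S finset.setT; last exact: xS.
  rewrite ST cardsT card_ord -xT le_eqVlt; apply/orP; left; apply/eqP.
  by apply: eq_bigl => i; rewrite finset.inE.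
by apply/seteqP; split=> x [Px /= E]; split=> //=;
  [rewrite dE E|apply: oppr_inj; rewrite -dE].
Qed.

Lemma tight_face (L : seq (seq 'I_n.+1)) :
  (forall l, l \in L -> uniq l /\ building e [set x in l]%SET) ->
  faces P (P `&` [set x | tight (x 0) L]).
Proof.
elim: L => [|l L IH] HL.
  rewrite (_ : _ `&` _ = P); first exact: faces_self.
  by apply/seteqP; split=> [x []//|x Px]; split.
have [ul Bl] := HL l (mem_head _ _).
have E (x : 'rV[R]_n.+1) : tight (x 0) (l :: L) <->
    \sum_(i in [set y in l]%SET) x 0 i = 3 ^+ #|[set y in l]%SET| /\ tight (x 0) L.
  rewrite tight_cons cardsE (card_uniqP ul).
  suff -> : \sum_(i in [set y in l]%SET) x 0 i = \sum_(i <- l) x 0 i by [].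
  by rewrite big_uniq //; apply: eq_bigl => i; rewrite finset.inE.
rewrite (_ : _ `&` _ = (P `&` [set x | \sum_(i in [set y in l]%SET) x 0 i = 3 ^+ #|[set y in l]%SET|])
    `&` (P `&` [set x | tight (x 0) L])).
  by apply: faces_setI; [exact: building_face|apply: IH => k kL; apply: HL; rewrite inE kL orbT].
apply/seteqP; split=> [x [Px /E[]]|x [[Px xl] [_ xL]]]; first by split.
by split=> //; apply/E.
Qed.

Lemma tight_vertex f (L : seq (seq 'I_n.+1)) :
  (forall l, l \in L -> uniq l /\ building e [set x in l]%SET) ->
  P (\row_v f v) -> tight f L ->
  (forall g, tight g L -> g =1 f) -> vertices P (\row_v f v).
Proof.
move=> HL Pf fL det; rewrite /vertices /=.
rewrite (_ : [set _] = P `&` [set x | tight (x 0) L]); first exact: tight_face.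
apply/seteqP; split=> [_ -> |x [_ /det xf]]; first by split=> //=; rewrite row_fun.
by apply/rowP => v; rewrite mxE xf.
Qed.

Lemma suffixes_building s l : conn_order e s -> l \in suffixes s ->
  uniq l /\ building e [set x in l]%SET.
Proof.
move=> cs /suffixesP[l0 [t sE]]; have cl : conn_order e l.
  by apply: (@conn_order_catr _ _ t); rewrite -sE.
by split; [exact: conn_order_uniq cl|exact: conn_order_building].
Qed.

Lemma conn_order_vertex f s : conn_order e s -> (forall v, v \in s) ->
  tight f (suffixes s) -> vertices P (\row_v f v).
Proof.
move=> cs sfull fs; have us := conn_order_uniq cs.
have s0 : s \in suffixes s by case: (s) (sfull ord0) => //= v l _; rewrite inE eqxx.
apply: (tight_vertex (L := suffixes s)) => //.
- by move=> l; exact: suffixes_building.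
- apply: (feasible_graph_assoc us sfull); last exact: fs.
  exact: feasible_suffixes.
- move=> g gs v.
  have E : [seq l ++ [::] | l <- suffixes s] = suffixes s.
    by rewrite (eq_map (@cats0 _)) map_id.
  by apply: (tight_inj (m := [::]) (t := s)); rewrite ?E // !big_nil.
Qed.

End Corners.

(** The conditions on [t] see only the set of vertices that come before, not their order. *)
Lemma conn_order_cat_perm (T : finType) (e : rel T) t m m' : perm_eq m m' ->
  conn_order e (t ++ m) -> conn_order e m' -> conn_order e (t ++ m').
Proof.
move=> mm; elim: t => //= v t IH /and3P[vt vE ct] cm'; rewrite IH // andbT.
have p : perm_eq (t ++ m) (t ++ m') by rewrite perm_cat2l.
by rewrite -(perm_mem p) vt -(eq_has_r (perm_mem p)) /nilp -(perm_size p).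
Qed.

Section Special.
Variables (R : realType) (n : nat) (e : rel 'I_n.+1).
Hypothesis econn : connected_graph e.

Let esym : symmetric e. Proof. by case: econn. Qed.

Local Notation P := (graph_assoc_set (R := R) e).

Lemma building_isolated (S : {set 'I_n.+1}) x D : building e S -> x \in S ->
  {subset S <= x :: D} -> ~~ has (e x) D -> S = [set x]%SET.
Proof.
move=> BS xS SD nx; apply/finset.setP => w; rewrite finset.inE.
have [->//|wx] := eqVneq w x; apply/negbTE/negP => wS.
have [||u [v []]] := building_exit esym (A := [:: x]) BS isT.
- by move=> z; rewrite inE => /eqP ->.
- by exists w; rewrite ?inE.
rewrite !inE => /eqP -> vS vx vu.
have := SD v vS; rewrite inE (negbTE vx) /= => vD.
by case/hasP: nx; exists v; rewrite // esym.
Qed.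

(* The set [x :: D] is disconnected here, so the point is tight on [[:: x]]
   instead. *)
Lemma special_vertex (f : 'I_n.+1 -> R) t x y D :
  conn_order e (t ++ [:: x, y & D]) -> (forall v, v \in t ++ [:: x, y & D]) ->
  ~~ nilp D -> ~~ has (e x) D -> f x = 3 ->
  tight f ([seq l ++ [:: x, y & D] | l <- suffixes t] ++
           [:: x, y & D] :: suffixes D) ->
  vertices P (\row_v f v).
Proof.
move=> cs sfull D0 nx fx /tight_cat[ft /tight_cons[fm fD]].
have us := conn_order_uniq cs.
have cm : conn_order e [:: x, y & D] := conn_order_catr cs.
have um := conn_order_uniq cm.
have cD : conn_order e D by case/and3P: cm => _ _ /and3P[].
have DD : D \in suffixes D by case: (D) D0 => //= v l _; rewrite inE eqxx.
have fDs : \sum_(v <- D) f v = 3 ^+ size D := fD _ DD.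
have d3 : 3 <= 3 ^+ size D :> R.
  by case: (D) D0 => //= v l _; rewrite exprS ler_peMr // exprn_ege1 // ler1n.
(* The total [9 * 3 ^ size D] less [3 ^ size D] on [D] and 3 at [x]. *)
have fyE : f y = 8 * 3 ^+ size D - 3.
  by move: fm; rewrite !big_cons /= !exprS fDs fx; lra.
(* Feasibility is built up with [x] before [y]: the only connected subset of [x :: D] through [x] is
   the singleton, and the coordinate at [y] is large enough for [feasible_cons]. *)
have p : perm_eq [:: x, y & D] [:: y, x & D].
  rewrite -[[:: x, y & D]]/([:: x] ++ [:: y] ++ D).
  by rewrite -[[:: y, x & D]]/([:: y] ++ [:: x] ++ D) perm_catCA.
have us' : uniq (t ++ [:: y, x & D]).
  by rewrite -(perm_uniq (s1 := t ++ [:: x, y & D])) // perm_cat2l.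
have ft' : tight f [seq l ++ [:: y, x & D] | l <- suffixes t].
  move=> _ /mapP[l lt ->]; rewrite size_cat -(perm_size p) -size_cat.
  rewrite -ft; last by apply/mapP; exists l.
  by apply: perm_big; rewrite perm_cat2l perm_sym.
have fxy : \sum_(v <- [:: y, x & D]) f v = 3 ^+ size [:: y, x & D].
  by rewrite -(perm_big _ p) fm.
have Ds : feasible e f (x :: D).
  move=> S BS SD; have [xS|xS] := boolP (x \in S).
    rewrite (building_isolated BS xS SD nx) finset.cards1 big_set1 fx.
    by rewrite expr1.
  apply: (feasible_suffixes (e := e) (conn_order_uniq cD) fD) => // w wS.
  have := SD w wS; rewrite inE => /orP[/eqP wx|//].
  by rewrite wx (negbTE xS) in wS.
have fxyD : feasible e f [:: y, x & D].
  apply: feasible_cons => //.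
  - by rewrite -(perm_uniq p).
  - by rewrite fyE /= exprS; lra.
apply: (tight_vertex
  (L := [:: x] :: [seq l ++ [:: x, y & D] | l <- suffixes t] ++
        [:: x, y & D] :: suffixes D)).
- move=> l; rewrite inE => /orP[/eqP ->|].
    split=> //; rewrite (_ : [set _ in _]%SET = [set x]%SET) ?building1 //.
    by apply/finset.setP => w; rewrite !finset.inE.
  rewrite mem_cat => /orP[lt|].
    by apply: (suffixes_building econn cs); rewrite suffixes_cat mem_cat lt.
  rewrite inE => /orP[/eqP ->|lD].
    by split=> //; exact: (conn_order_building esym cm).
  exact: (suffixes_building econn cD).
- apply: (feasible_graph_assoc us') => [v||].
  + by rewrite -(perm_mem (s1 := t ++ [:: x, y & D])) // perm_cat2l.
  + by apply: feasible_cat => //; rewrite fxy eqxx orbT.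
  + case: (t) ft' => [|v l] //= ft'; apply: (ft' (v :: l ++ [:: y, x & D])).
    by rewrite /= inE eqxx.
- by apply/tight_cons; rewrite big_seq1 fx expr1; split=> //; apply/tight_cat; split=> //; apply/tight_cons.
- move=> g /tight_cons[gx /tight_cat[gt /tight_cons[gm gD]]].
  have gDf : {in D, g =1 f}.
    have E : [seq l ++ [::] | l <- suffixes D] = suffixes D.
      by rewrite (eq_map (@cats0 _)) map_id.
    by apply: (tight_inj (m := [::])); rewrite ?E // !big_nil.
  have gxf : g x = f x by move: gx; rewrite big_seq1 fx => ->; rewrite expr1.
  have gyf : g y = f y.
    have : \sum_(v <- [:: x, y & D]) g v = \sum_(v <- [:: x, y & D]) f v.
      by rewrite gm fm.
    by rewrite !big_cons gxf (eq_big_seq _ gDf) => /addrI/addIr.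
  have gtf : {in t, g =1 f} by apply: tight_inj gt ft; rewrite gm fm.
  move=> v; have := sfull v; rewrite mem_cat !inE.
  by move=> /orP[/gtf//|/orP[/eqP ->//|/orP[/eqP ->//|/gDf]]].
Qed.

End Special.

(** Abel summation: the left side equals [u3 * W - (u3 - u2) * (x1 + x2) - (u2 - u1) * x1], which is
    largest when the partial sums are smallest. *)
Lemma greedy3 (R : realFieldType) (u1 u2 u3 x1 x2 x3 w1 w12 W : R) :
  u1 <= u2 -> u2 <= u3 -> w1 <= x1 -> w12 <= x1 + x2 -> x1 + x2 + x3 = W ->
  u1 * x1 + u2 * x2 + u3 * x3 <=
  u1 * w1 + u2 * (w12 - w1) + u3 * (W - w12).
Proof.
move=> u12 u23 le1 le12 <-.
have : 0 <= (u2 - u1) * (x1 - w1) by rewrite mulr_ge0 ?subr_ge0.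
have : 0 <= (u3 - u2) * (x1 + x2 - w12) by rewrite mulr_ge0 ?subr_ge0.
lra.
Qed.

(** * Two-dimensional faces with three varying coordinates *)

Section TwoFaces.
Variables (R : realType) (n : nat) (e : rel 'I_n.+1).
Hypothesis econn : connected_graph e.
Variables (t D : seq 'I_n.+1) (a b c : 'I_n.+1).

Let esym : symmetric e. Proof. by case: econn. Qed.

Local Notation P := (graph_assoc_set (R := R) e).
Let m := [:: c, b, a & D].

Hypothesis cs : conn_order e (t ++ m).
Hypothesis sfull : forall v, v \in t ++ m.

(** The suffixes of [t ++ m] other than [a :: D] and [[:: b, a & D]]; the two omitted equalities
    leave two degrees of freedom, spent on the coordinates at [a], [b], [c]. *)
Definition chain := [seq l ++ m | l <- suffixes t] ++ m :: suffixes D.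

Definition two_face : set 'rV[R]_n.+1 := P `&` [set x | tight (x 0) chain].

Let us : uniq (t ++ m) := conn_order_uniq cs.
Let cm : conn_order e m := conn_order_catr cs.
Let um : uniq m := conn_order_uniq cm.

(** The sum over [D] on the face; the pentagon has [D] empty, where the power of 3 would wrongly
    give 1. *)
Definition base_sum : R := if nilp D then 0 else 3 ^+ size D.

Lemma tight_base_sum (f : 'I_n.+1 -> R) :
  tight f chain -> \sum_(v <- D) f v = base_sum.
Proof.
move=> /tight_cat[_ /tight_cons[_ fD]]; rewrite /base_sum.
case: (D) fD => [|v l] fD; first by rewrite big_nil.
by rewrite fD //= inE eqxx.
Qed.

Lemma tight_sum3 (f : 'I_n.+1 -> R) : tight f chain ->
  f a + f b + f c = 27 * 3 ^+ size D - base_sum.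
Proof.
move=> fc; have /tight_cat[_ /tight_cons[]] := fc.
by rewrite !big_cons (tight_base_sum fc) /= !exprS; lra.
Qed.

(** Any point of the face has this form: away from [a], [b], [c] the chain forces the coordinates of
    the ordering [t ++ m]. *)
Definition coord3 (p : R * R * R) (v : 'I_n.+1) : R :=
  if v == a then p.1.1 else if v == b then p.1.2 else if v == c then p.2
  else order_point R (t ++ m) v.

Let abc : [/\ a != b, a != c & b != c].
Proof.
move: um; rewrite /m /= !inE !negb_or -!andbA.
by move=> /and5P[cb ca _ ba _]; split; rewrite eq_sym.
Qed.

Lemma coord3a p : coord3 p a = p.1.1.
Proof. by rewrite /coord3 eqxx. Qed.

Lemma coord3b p : coord3 p b = p.1.2.
Proof. by have [ab _ _] := abc; rewrite /coord3 eq_sym (negbTE ab) eqxx. Qed.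

Lemma coord3c p : coord3 p c = p.2.
Proof.
have [_ ac bc] := abc.
by rewrite /coord3 [c == a]eq_sym [c == b]eq_sym (negbTE ac) (negbTE bc) eqxx.
Qed.

Lemma coord3_other p v : v \notin [:: c; b; a] ->
  coord3 p v = order_point R (t ++ m) v.
Proof.
by rewrite !inE !negb_or /coord3 => /and3P[/negbTE -> /negbTE -> /negbTE ->].
Qed.

Let order_chain : tight (order_point R (t ++ m)) chain.
Proof.
move=> l; have := order_point_tight R us (l := l).
rewrite suffixes_cat /chain !mem_cat /= !inE => H lc; apply: H.
by case/orP: lc => [->//|/orP[->|->]]; rewrite ?orbT.
Qed.

Let D_other v : v \in D -> v \notin [:: c; b; a].
Proof.
move=> vD; have : uniq ([:: c; b; a] ++ D) := um.
by rewrite cat_uniq => /and3P[_ /hasPn H _]; exact: H.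
Qed.

Let t_other v : v \in t -> v \notin [:: c; b; a].
Proof.
move=> vt; have := us; rewrite cat_uniq => /and3P[_ /hasPn H _].
apply/negP => va; have vm : v \in m by rewrite -[m]/([:: c; b; a] ++ D) mem_cat va.
by have := H v vm; rewrite /= vt.
Qed.

Lemma coord3_tight p : p.1.1 + p.1.2 + p.2 = 27 * 3 ^+ size D - base_sum ->
  tight (coord3 p) chain.
Proof.
move=> pW; have oc := order_chain.
have om : \sum_(v <- m) coord3 p v = \sum_(v <- m) order_point R (t ++ m) v.
  have := tight_sum3 oc; rewrite -pW /m !big_cons coord3a coord3b coord3c.
  rewrite (eq_big_seq (order_point R (t ++ m))) => [|v /D_other]; last exact: coord3_other.
  by lra.
move=> l lc; rewrite -(oc l lc); move: lc; rewrite mem_cat inE.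
case/orP => [/mapP[k kt ->]|/orP[/eqP -> //|lD]].
  rewrite !big_cat /= om; congr (_ + _); apply: eq_big_seq => v vk.
  apply: coord3_other; apply: t_other; have [_ [k' ->]] := suffixesP kt.
  by rewrite mem_cat vk orbT.
apply: eq_big_seq => v vl; apply: coord3_other; apply: D_other.
by have [_ [k' ->]] := suffixesP lD; rewrite mem_cat vl orbT.
Qed.

(** The remaining coordinates are fixed by the chain, so on the face a functional depends, up to a
    constant, on three coordinates. *)
Lemma dotp3 (u x : 'rV[R]_n.+1) : tight (x 0) chain ->
  dotp u x = (u 0 a * x 0 a + u 0 b * x 0 b + u 0 c * x 0 c) +
    \sum_(v | v \notin [:: c; b; a]) u 0 v * order_point R (t ++ m) v.
Proof.
move=> xc; have oc := order_chain; have [ab ac bc] := abc.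
rewrite /dotp (bigID (mem [:: c; b; a])) /=; congr (_ + _).
  rewrite -big_uniq /=; last first.
    by rewrite !inE !negb_or ![_ == a]eq_sym [c == b]eq_sym ab ac bc.
  by rewrite !big_cons big_nil; lra.
apply: eq_bigr => v vabc; congr (_ * _).
have /tight_cat[xt /tight_cons[xm xD]] := xc.
have /tight_cat[ot /tight_cons[om oD]] := oc.
have := sfull v; rewrite mem_cat => /orP[vt|].
  by apply: (tight_inj _ xt ot) => //; rewrite xm om.
rewrite -[m]/([:: c; b; a] ++ D) mem_cat (negbTE vabc) /= => vD.
have E : [seq l ++ [::] | l <- suffixes D] = suffixes D.
  by rewrite (eq_map (@cats0 _)) map_id.
by apply: (tight_inj (m := [::])) vD; rewrite ?E // !big_nil.
Qed.

Lemma two_face_faces : faces P two_face.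
Proof.
apply: tight_face => // l; rewrite mem_cat inE => lc.
have cD : conn_order e D.
  by move: cm => /and3P[_ _ /and3P[_ _ /and3P[]]].
case/orP: lc => [lt|/orP[/eqP ->|lD]].
- by apply: (suffixes_building econn cs); rewrite suffixes_cat mem_cat lt.
- by split=> //; exact: (conn_order_building esym cm).
- exact: (suffixes_building econn cD).
Qed.

(** By [dotp3], counting vertices comes down to listing triples among which every functional in
    three variables attains its maximum. *)
Lemma two_face_nb_vertices (ps : seq (R * R * R)) : uniq ps -> ~~ nilp ps ->
  (forall p, p \in ps -> p.1.1 + p.1.2 + p.2 = 27 * 3 ^+ size D - base_sum /\
     vertices P (\row_v coord3 p v)) ->
  (forall x u1 u2 u3, two_face x -> exists2 p, p \in ps &
     u1 * x 0 a + u2 * x 0 b + u3 * x 0 c <= u1 * p.1.1 + u2 * p.1.2 + u3 * p.2) ->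
  nfaces P two_face /\ nb_vertices two_face (size ps).
Proof.
move=> ups ps0 psP psM.
pose pt p : 'rV[R]_n.+1 := \row_v coord3 p v.
have ptG p : p \in ps -> two_face (pt p).
  move=> /psP[pW pv]; split; first exact: (faces_sub pv).
  by rewrite /= row_fun; exact: coord3_tight.
have nG : nfaces P two_face.
  split; first exact: two_face_faces.
  by case: (ps) ps0 ptG => // p l _ ptG; exists (pt p); apply: ptG; rewrite inE eqxx.
split=> //; rewrite -(size_map pt); apply: nb_vertices_of.
- rewrite map_inj_uniq // => p q /rowP E.
  have Ea := E a; have Eb := E b; have Ec := E c.
  rewrite !mxE !coord3a in Ea; rewrite !mxE !coord3b in Eb; rewrite !mxE !coord3c in Ec.
  by case: p q {E} Ea Eb Ec => [[? ?] ?] [[? ?] ?] /= -> -> ->.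
- move=> _ /mapP[p pps ->]; have [_ pv] := psP p pps.
  have pG : [set pt p] `<=` two_face by move=> _ ->; exact: ptG.
  by have [] := (nface_trans [set pt p] (graph_assoc_is_polytope R e) nG).2
    (conj (vertices_nface pv) pG).
- move=> u x Gx; have [p pps le] := psM x (u 0 a) (u 0 b) (u 0 c) Gx.
  exists (pt p); first by apply/mapP; exists p.
  rewrite (dotp3 _ Gx.2) (dotp3 _ (ptG p pps).2) lerD2r !mxE.
  by rewrite coord3a coord3b coord3c.
Qed.

(* The vertices of the two-dimensional face reached by ordering [x] before [y]
   before [z]. *)
Lemma corner_vertex (f : 'I_n.+1 -> R) x y z : tight f chain ->
  perm_eq [:: z; y; x] [:: c; b; a] -> conn_order e [:: z, y, x & D] ->
  f x = 3 * 3 ^+ size D - base_sum -> f y = 6 * 3 ^+ size D ->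
  vertices P (\row_v f v).
Proof.
move=> fc p cz fx fy; have fD := tight_base_sum fc.
have pm : perm_eq [:: z, y, x & D] m.
  by rewrite -[m]/([:: c; b; a] ++ D) -[[:: z, y, x & D]]/([:: z; y; x] ++ D) perm_cat2r.
have ct : conn_order e (t ++ [:: z, y, x & D]).
  by apply: conn_order_cat_perm cs cz; rewrite perm_sym.
apply: (conn_order_vertex econn ct) => [v|].
  by rewrite (perm_mem (s2 := t ++ m)) // perm_cat2l.
have /tight_cat[ft /tight_cons[fm fDs]] := fc.
rewrite suffixes_cat; apply/tight_cat; split.
  move=> _ /mapP[l lt ->]; rewrite size_cat (perm_size pm) -size_cat.
  rewrite -ft; last by apply/mapP; exists l.
  by apply: perm_big; rewrite perm_cat2l.
apply/tight_cons; split; first by rewrite (perm_big _ pm) (perm_size pm).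
apply/tight_cons; split; first by rewrite !big_cons fx fy fD /= !exprS; lra.
by apply/tight_cons; split=> //; rewrite !big_cons fx fD /= !exprS; lra.
Qed.

Lemma two_face_ge (x : 'rV[R]_n.+1) l : two_face x -> conn_order e (l ++ D) ->
  ~~ nilp l -> 3 ^+ size (l ++ D) <= \sum_(v <- l) x 0 v + base_sum.
Proof.
move=> [Px xc] cl l0; rewrite -(tight_base_sum xc) -big_cat /=.
have [xT xS] := Px; have ul := conn_order_uniq cl.
have BS : building e [set v in l ++ D]%SET.
  by apply: (conn_order_building esym cl); case: (l) l0.
have E : \sum_(i in [set v in l ++ D]%SET) x 0 i = \sum_(v <- l ++ D) x 0 v.
  by rewrite big_uniq //; apply: eq_bigl => i; rewrite finset.inE.
have C : #|[set v in l ++ D]%SET| = size (l ++ D) by rewrite cardsE (card_uniqP ul).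
have [ST|ST] := eqVneq [set v in l ++ D]%SET finset.setT; last first.
  by have := xS _ BS ST; rewrite E C.
rewrite -C -E ST cardsT card_ord -xT le_eqVlt; apply/orP; left; apply/eqP.
by apply: eq_bigl => i; rewrite finset.inE.
Qed.

End TwoFaces.

(* Coordinates at [a], [b], [c] of the vertices of [two_face]: the pentagon is
   the case [D = [::]] with [a - b - c] an induced path; for the hexagon
   [d = 3 ^+ size D] and [w] is the least possible coordinate at [b], namely
   [2 * d] if [b] is adjacent to [D] and [3] otherwise. *)
Section CornerCoordinates.
Variable R : realFieldType.

Definition pentagon_points : seq (R * R * R) :=
  [:: (3, 6, 18); (6, 3, 18); (18, 3, 6); (18, 6, 3); (3, 21, 3)].

Lemma pentagon_points_uniq : uniq pentagon_points.
Proof.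
rewrite /= !inE !negb_or; repeat (apply/andP; split); rewrite //;
  apply/eqP => -[]; lra.
Qed.

Lemma pentagon_points_sum p :
  p \in pentagon_points -> p.1.1 + p.1.2 + p.2 = 27.
Proof.
by rewrite !inE => /orP[|/orP[|/orP[|/orP[|]]]] /eqP -> /=; lra.
Qed.

(** Each ordering of [u1], [u2], [u3] selects a point. The two orderings with [u2] largest share
    [(3, 21, 3)], as [x1 + x3] has no bound of its own; the other four give 3, [9 - 3] and [27 - 9]
    through [greedy3]. *)
Lemma pentagon_points_max (u1 u2 u3 x1 x2 x3 : R) :
  x1 + x2 + x3 = 27 -> 3 <= x1 -> 3 <= x2 -> 3 <= x3 ->
  9 <= x1 + x2 -> 9 <= x2 + x3 ->
  exists2 p, p \in pentagon_points &
    u1 * x1 + u2 * x2 + u3 * x3 <= u1 * p.1.1 + u2 * p.1.2 + u3 * p.2.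
Proof.
move=> S g1 g2 g3 g12 g23.
have [u12|/ltW u21] := leP u1 u2.
  have [u23|/ltW u32] := leP u2 u3.
    exists (3, 6, 18); first by rewrite !inE eqxx ?orbT.
    by have := greedy3 u12 u23 g1 g12 S; rewrite /=; lra.
  exists (3, 21, 3); first by rewrite !inE eqxx ?orbT.
  (* The two products add up to the difference of the sides once [x2] is eliminated. *)
  have h1 : 0 <= (u2 - u1) * (x1 - 3) by rewrite mulr_ge0 ?subr_ge0.
  have h3 : 0 <= (u2 - u3) * (x3 - 3) by rewrite mulr_ge0 ?subr_ge0.
  have E2 : x2 = 27 - x1 - x3 by lra.
  by move: h1 h3; rewrite /= E2 {g1 g2 g3 g12 g23 S E2}; lra.
have [u13|/ltW u31] := leP u1 u3.
  exists (6, 3, 18); first by rewrite !inE eqxx ?orbT.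
  by have := @greedy3 R u2 u1 u3 x2 x1 x3 3 9 27; rewrite /=; lra.
have [u23|/ltW u32] := leP u2 u3.
  exists (18, 3, 6); first by rewrite !inE eqxx ?orbT.
  by have := @greedy3 R u2 u3 u1 x2 x3 x1 3 9 27; rewrite /=; lra.
exists (18, 6, 3); first by rewrite !inE eqxx ?orbT.
by have := @greedy3 R u3 u2 u1 x3 x2 x1 3 9 27; rewrite /=; lra.
Qed.

Definition hexagon_points (d w : R) : seq (R * R * R) :=
  [:: (2 * d, 6 * d, 18 * d); (2 * d, 18 * d, 6 * d); (6 * d, 18 * d, 2 * d);
      (18 * d, 6 * d, 2 * d); (8 * d - w, w, 18 * d); (18 * d, w, 8 * d - w)].

Lemma hexagon_points_uniq d w : 0 < w <= 2 * d -> uniq (hexagon_points d w).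
Proof.
move=> /andP[w0 wd]; rewrite /= !inE !negb_or.
repeat (apply/andP; split); rewrite //; apply/eqP => -[]; lra.
Qed.

Lemma hexagon_points_sum d w p :
  p \in hexagon_points d w -> p.1.1 + p.1.2 + p.2 = 26 * d.
Proof.
by rewrite !inE => /orP[|/orP[|/orP[|/orP[|/orP[|]]]]] /eqP -> /=; lra.
Qed.

(** Each ordering of [u1], [u2], [u3] selects one point, with partial sums pushed down to [2 * d]
    (or [w] at [b]), then [8 * d], then [26 * d]: these are [3 * d], [9 * d] and [27 * d] less the
    sum [d] over [D]. *)
Lemma hexagon_points_max (d w u1 u2 u3 x1 x2 x3 : R) :
  x1 + x2 + x3 = 26 * d -> 2 * d <= x1 -> w <= x2 -> 2 * d <= x3 ->
  8 * d <= x1 + x2 -> 8 * d <= x2 + x3 -> 8 * d <= x1 + x3 ->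
  exists2 p, p \in hexagon_points d w &
    u1 * x1 + u2 * x2 + u3 * x3 <= u1 * p.1.1 + u2 * p.1.2 + u3 * p.2.
Proof.
move=> S g1 g2 g3 g12 g23 g13.
have [u12|/ltW u21] := leP u1 u2.
  have [u23|/ltW u32] := leP u2 u3.
    exists (2 * d, 6 * d, 18 * d); first by rewrite !inE eqxx ?orbT.
    by have := greedy3 u12 u23 g1 g12 S; rewrite /=; lra.
  have [u13|/ltW u31] := leP u1 u3.
    exists (2 * d, 18 * d, 6 * d); first by rewrite !inE eqxx ?orbT.
    have S' : x1 + x3 + x2 = 26 * d by lra.
    by have := greedy3 u13 u32 g1 g13 S'; rewrite /=; lra.
  exists (6 * d, 18 * d, 2 * d); first by rewrite !inE eqxx ?orbT.
  have S' : x3 + x1 + x2 = 26 * d by lra.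
  rewrite addrC in g13.
  by have := greedy3 u31 u12 g3 g13 S'; rewrite /=; lra.
have [u13|/ltW u31] := leP u1 u3.
  exists (8 * d - w, w, 18 * d); first by rewrite !inE eqxx ?orbT.
  have S' : x2 + x1 + x3 = 26 * d by lra.
  rewrite addrC in g12.
  by have := greedy3 u21 u13 g2 g12 S'; rewrite /=; lra.
have [u23|/ltW u32] := leP u2 u3.
  exists (18 * d, w, 8 * d - w); first by rewrite !inE eqxx ?orbT.
  have S' : x2 + x3 + x1 = 26 * d by lra.
  by have := greedy3 u23 u31 g2 g23 S'; rewrite /=; lra.
exists (18 * d, 6 * d, 2 * d); first by rewrite !inE eqxx ?orbT.
have S' : x3 + x2 + x1 = 26 * d by lra.
rewrite addrC in g23.
by have := greedy3 u32 u21 g3 g23 S'; rewrite /=; lra.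
Qed.

End CornerCoordinates.

(** * Pentagonal and hexagonal faces *)

Section TwoFaceCounts.
Variables (R : realType) (n : nat) (e : rel 'I_n.+1).
Hypothesis econn : connected_graph e.

Let esym : symmetric e. Proof. by case: econn. Qed.

Local Notation P := (graph_assoc_set (R := R) e).

Lemma pentagon_two_face t a b c : conn_order e (t ++ [:: c; b; a]) ->
  (forall v, v \in t ++ [:: c; b; a]) -> e a b -> e b c -> ~~ e a c ->
  nfaces P (two_face (R := R) e t [::] a b c) /\
  nb_vertices (two_face (R := R) e t [::] a b c) 5.
Proof.
move=> cs sfull ab bc nac.
have um := conn_order_uniq (conn_order_catr cs).
have [ba cb] : e b a /\ e c b by rewrite [e b a]esym [e c b]esym.
have := um; rewrite /= !inE !negb_or -!andbA !andbT => /and3P[cb' ca' ba'].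
have B0 : base_sum R ([::] : seq 'I_n.+1) = 0 by [].
have W p : p \in pentagon_points R -> p.1.1 + p.1.2 + p.2 = 27 * 3 ^+ 0 - 0 :> R.
  by move=> /pentagon_points_sum ->; rewrite expr0; lra.
apply: (two_face_nb_vertices econn cs sfull (ps := pentagon_points R)) => //.
- exact: pentagon_points_uniq.
- move=> p pps; split; first exact: W.
  have pc := coord3_tight cs (W p pps).
  have pa := coord3a t [::] a b c p; have pb := coord3b cs p; have pc' := coord3c cs p.
  move: pps; rewrite !inE => /orP[|/orP[|/orP[|/orP[|]]]] /eqP pE.
  + apply: (corner_vertex econn cs sfull pc (x := a) (y := b) (z := c)) => //.
    * exact: conn_order_catr cs.
    * by rewrite pa pE B0 /=; lra.
    * by rewrite pb pE /=; lra.
  + apply: (corner_vertex econn cs sfull pc (x := b) (y := a) (z := c)) => //.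
    * by case: (perm_eq3 a b c).
    * by rewrite /= !inE !negb_or cb' ca' eq_sym ba' ab cb ?orbT.
    * by rewrite pb pE B0 /=; lra.
    * by rewrite pa pE /=; lra.
  + apply: (corner_vertex econn cs sfull pc (x := b) (y := c) (z := a)) => //.
    * by case: (perm_eq3 a b c).
    * by rewrite /= !inE !negb_or cb' ![a == _]eq_sym ca' ba' ab cb ?orbT.
    * by rewrite pb pE B0 /=; lra.
    * by rewrite pc' pE /=; lra.
  + apply: (corner_vertex econn cs sfull pc (x := c) (y := b) (z := a)) => //.
    * by case: (perm_eq3 a b c).
    * by rewrite /= !inE !negb_or [b == c]eq_sym cb' ![a == _]eq_sym ca' ba' ab bc ?orbT.
    * by rewrite pc' pE B0 /=; lra.
    * by rewrite pb pE /=; lra.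
  (* At the corner [(3, 21, 3)] both [a] and [c] are tight as singletons; with [[:: a]] as [D], the
     vertex [c] is the one without a neighbour in [D]. *)
  + apply: (special_vertex econn (t := t) (x := c) (y := b) (D := [:: a])) => //.
    * by rewrite /= orbF esym.
    * by rewrite pc' pE.
    * have /tight_cat[pt /tight_cons[pm _]] := pc.
      apply/tight_cat; split=> //; apply/tight_cons; split=> //.
      by apply/tight_cons; split=> //; rewrite big_seq1 pa pE /= expr1.
- move=> x u1 u2 u3 Gx.
  have S := tight_sum3 Gx.2; rewrite /= B0 in S.
  have ge := two_face_ge econn Gx.
  have := ge [:: a] isT isT; rewrite big_seq1 B0 /= => ga.
  have := ge [:: b] isT isT; rewrite big_seq1 B0 /= => gb.
  have := ge [:: c] isT isT; rewrite big_seq1 B0 /= => gc.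
  have := ge [:: b; a] _ isT; rewrite !big_cons big_nil B0 /= !inE ba' ba => /(_ isT) gba.
  have := ge [:: c; b] _ isT; rewrite !big_cons big_nil B0 /= !inE cb' cb => /(_ isT) gcb.
  rewrite !exprS !expr0 in S ga gb gc gba gcb.
  by apply: pentagon_points_max; lra.
Qed.

(** This replaces [corner_vertex] for the order [x], [y], [z] when [x] is not adjacent to [D]: the
    singleton of [x] is tight in place of [x :: D], and [z] joins the vertices added afterwards. *)
Lemma special_corner (f : 'I_n.+1 -> R) t D a b c x y z :
  conn_order e (t ++ [:: c, b, a & D]) ->
  (forall v, v \in t ++ [:: c, b, a & D]) -> tight f (chain t D a b c) ->
  perm_eq [:: z; x; y] [:: c; b; a] -> conn_order e [:: z, x, y & D] ->
  ~~ nilp D -> ~~ has (e x) D -> f x = 3 -> f y = 8 * 3 ^+ size D - 3 ->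
  vertices P (\row_v f v).
Proof.
move=> cs sfull fc p cz D0 nx fx fy; have fD := tight_base_sum fc.
have pm : perm_eq [:: z, x, y & D] [:: c, b, a & D].
  by rewrite -[[:: c, b, a & D]]/([:: c; b; a] ++ D)
    -[[:: z, x, y & D]]/([:: z; x; y] ++ D) perm_cat2r.
have tE l : (l ++ [:: z]) ++ [:: x, y & D] = l ++ [:: z, x, y & D] by rewrite -catA.
have /tight_cat[ft /tight_cons[fm fDs]] := fc.
apply: (special_vertex econn (t := t ++ [:: z]) (x := x) (y := y) (D := D)) => //.
- by rewrite tE; apply: conn_order_cat_perm cs cz; rewrite perm_sym.
- by move=> v; rewrite tE (perm_mem (s2 := t ++ [:: c, b, a & D])) // perm_cat2l.
apply/tight_cat; split; last first.
  apply/tight_cons; split=> //.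
  by rewrite !big_cons fx fy fD /base_sum (negbTE D0) /= !exprS; lra.
rewrite suffixes_cat map_cat; apply/tight_cat; split; last first.
  by apply/tight_cons; split=> //=; rewrite (perm_big _ pm) fm.
move=> _ /mapP[_ /mapP[l lt ->] ->]; rewrite tE size_cat (perm_size pm) -size_cat.
rewrite -ft; last by apply/mapP; exists l.
by apply: perm_big; rewrite perm_cat2l.
Qed.

Lemma hexagon_two_face t D a b c : triangle_minor e D a b c ->
  conn_order e (t ++ [:: c, b, a & D]) ->
  (forall v, v \in t ++ [:: c, b, a & D]) ->
  nfaces P (two_face (R := R) e t D a b c) /\ nb_vertices (two_face (R := R) e t D a b c) 6.
Proof.
move=> [cD D0 um /andP[aD hcD] bD] cs sfull.
pose d : R := 3 ^+ size D.
have d3 : 3 <= d.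
  by rewrite /d; case: (D) D0 => //= v l _; rewrite exprS ler_peMr // exprn_ege1 // ler1n.
have B : base_sum R D = d by rewrite /base_sum (negbTE D0).
pose wb : R := if has (e b) D then 2 * d else 3.
have wb3 : 3 <= wb by rewrite /wb; case: ifP => _ //; lra.
have wbd : wb <= 2 * d by rewrite /wb; case: ifP => _ //; lra.
have W p : p \in hexagon_points d wb ->
    p.1.1 + p.1.2 + p.2 = 27 * 3 ^+ size D - base_sum R D.
  by move=> /hexagon_points_sum ->; rewrite B -/d; lra.
have := um; rewrite /= !inE !negb_or -!andbA.
move=> /and5P[cb' ca' cD' ba' /and3P[bD' aD' _]].
have [[ab' ac'] bc'] : (a != b /\ a != c) /\ b != c by rewrite ![_ == c]eq_sym eq_sym.
have nbr x y : has (e x) D -> nilp (y :: D) || has (e x) (y :: D).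
  by move=> /= ->; rewrite orbT.
have ord_abc : conn_order e [:: c, b, a & D].
  exact: conn_order_catr cs.
have ba_or : has (e b) (a :: D) by rewrite /=; case/orP: bD => [->|/andP[->]]; rewrite ?orbT.
have bc_or : has (e b) (c :: D) by rewrite /=; case/orP: bD => [->|/andP[_ ->]]; rewrite ?orbT.
have ord_ba : conn_order e [:: b, a & D].
  by case/and3P: ord_abc.
have ord_bc : conn_order e [:: b, c & D].
  by rewrite /= inE negb_or bc' bD' /= -[e b c || _]/(has (e b) (c :: D)) bc_or cD' hcD cD orbT.
have ord_ca : conn_order e [:: c, a & D].
  by rewrite /= inE negb_or ca' cD' hcD aD' aD cD !orbT.
have ord_ac : conn_order e [:: a, c & D].
  by rewrite /= inE negb_or ac' cD' hcD aD' aD cD !orbT.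
have ord_a : conn_order e (a :: D) by rewrite /= aD' aD cD orbT.
have ord_c : conn_order e (c :: D) by rewrite /= cD' hcD cD orbT.
apply: (two_face_nb_vertices econn cs sfull (ps := hexagon_points d wb)) => //.
- by apply: hexagon_points_uniq; apply/andP; split; lra.
- move=> p pps; split; first exact: W.
  have pc := coord3_tight cs (W p pps).
  have pa := coord3a t D a b c p; have pb := coord3b cs p; have pc' := coord3c cs p.
  move: pps; rewrite !inE => /orP[|/orP[|/orP[|/orP[|/orP[|]]]]] /eqP pE.
  + apply: (corner_vertex econn cs sfull pc (x := a) (y := b) (z := c)) => //.
    * by rewrite pa pE B /= -/d; lra.
    * by rewrite pb pE /=.
  + apply: (corner_vertex econn cs sfull pc (x := a) (y := c) (z := b)) => //.
    * by case: (perm_eq3 a b c).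
    * apply: conn_order_cons => //; first by rewrite !inE !negb_or bc' ba' bD'.
      by move: ba_or => /= /orP[->|->]; rewrite ?orbT.
    * by rewrite pa pE B /= -/d; lra.
    * by rewrite pc' pE /=.
  + apply: (corner_vertex econn cs sfull pc (x := c) (y := a) (z := b)) => //.
    * by case: (perm_eq3 a b c).
    * apply: conn_order_cons => //; first by rewrite !inE !negb_or bc' ba' bD'.
      by move: bc_or => /= /orP[->|->]; rewrite ?orbT.
    * by rewrite pc' pE B /= -/d; lra.
    * by rewrite pa pE /=.
  + apply: (corner_vertex econn cs sfull pc (x := c) (y := b) (z := a)) => //.
    * by case: (perm_eq3 a b c).
    * apply: conn_order_cons => //; first by rewrite !inE !negb_or ac' ab' aD'.
      by rewrite /= aD !orbT.
    * by rewrite pc' pE B /= -/d; lra.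
    * by rewrite pb pE /=.
  (* In the last two corners [b] comes first, so they depend on whether [b :: D] is connected. *)
  + have [hb|hb] := boolP (has (e b) D).
      apply: (corner_vertex econn cs sfull pc (x := b) (y := a) (z := c)) => //.
      * by case: (perm_eq3 a b c).
      * apply: conn_order_cons; first by rewrite !inE !negb_or ca' cb' cD'.
          by rewrite /= hcD !orbT.
        apply: conn_order_cons; first by rewrite !inE !negb_or ab' aD'.
          by rewrite /= aD !orbT.
        by apply: conn_order_cons.
      * by rewrite pb pE B /= /wb hb -/d; lra.
      * by rewrite pa pE /= /wb hb -/d; lra.
    apply: (special_corner (x := b) (y := a) (z := c) cs sfull pc) => //.
    * by rewrite pb pE /= /wb (negbTE hb).
    * by rewrite pa pE /= /wb (negbTE hb).
  + have [hb|hb] := boolP (has (e b) D).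
      apply: (corner_vertex econn cs sfull pc (x := b) (y := c) (z := a)) => //.
      * by case: (perm_eq3 a b c).
      * apply: conn_order_cons; first by rewrite !inE !negb_or ac' ab' aD'.
          by rewrite /= aD !orbT.
        apply: conn_order_cons; first by rewrite !inE !negb_or cb' cD'.
          by rewrite /= hcD !orbT.
        by apply: conn_order_cons.
      * by rewrite pb pE B /= /wb hb -/d; lra.
      * by rewrite pc' pE /= /wb hb -/d; lra.
    apply: (special_corner (x := b) (y := c) (z := a) cs sfull pc) => //.
    * by case: (perm_eq3 a b c).
    * apply: conn_order_cons => //; first by rewrite !inE !negb_or ab' ac' aD'.
      by rewrite /= aD !orbT.
    * by rewrite pb pE /= /wb (negbTE hb).
    * by rewrite pc' pE /= /wb (negbTE hb).
- move=> x u1 u2 u3 Gx.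
  have S := tight_sum3 Gx.2; rewrite B -/d in S.
  have ge := two_face_ge econn Gx.
  have := ge [:: a] ord_a isT; rewrite big_seq1 B /= exprS -/d => ga.
  have := ge [:: c] ord_c isT; rewrite big_seq1 B /= exprS -/d => gc.
  have := ge [:: b; a] ord_ba isT; rewrite !big_cons big_nil B /= !exprS -/d => gba.
  have := ge [:: b; c] ord_bc isT; rewrite !big_cons big_nil B /= !exprS -/d => gbc.
  have := ge [:: c; a] ord_ca isT; rewrite !big_cons big_nil B /= !exprS -/d => gca.
  have gb : wb <= x 0 b.
    rewrite /wb; case: ifP => hb.
      have ob : conn_order e (b :: D) by exact: conn_order_cons.
      have := ge [:: b] ob isT; rewrite big_seq1 B /= exprS -/d; lra.
    have [[_ xS] _] := Gx; have := xS _ (building1 e b).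
    rewrite finset.cards1 big_set1 expr1; apply; apply/eqP => /finset.setP/(_ a).
    by rewrite !finset.inE (negbTE ab').
  by apply: hexagon_points_max; lra.
Qed.

End TwoFaceCounts.

(** * Counting the vertices of graph-associahedra *)

Section OrderPointInj.
Variables (R : realType) (T : finType).
Implicit Types s : seq T.

Lemma order_point_lt s v : v \in s -> order_point R s v < 2 * 3 ^+ size s.
Proof.
elim: s => // w s IH; rewrite inE /= exprS.
have p : 1 <= 3 ^+ size s :> R by rewrite exprn_ege1 // ler1n.
have [_ _|vw /IH lt] := eqVneq v w; last by apply: lt_trans lt _; lra.
by case: ifP => _; lra.
Qed.

(** The vertex at the head of the list has the strictly largest coordinate, by [order_point_lt], so
    the ordering can be read off from the point. *)
Lemma order_point_inj s s' : uniq s -> uniq s' -> s =i s' ->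
  {in s, order_point R s =1 order_point R s'} -> s = s'.
Proof.
elim: s s' => [|v s IH] s' us us' ss'.
  by case: s' ss' {us'} => // w s' /(_ w); rewrite !inE eqxx.
have /perm_size : perm_eq (v :: s) s' by apply: uniq_perm.
case: s' us' ss' => // w s' us' ss' [sz] E.
have vw : v = w.
  apply/eqP/negPn/negP => vw; have vs' : v \in s'.
    by have := ss' v; rewrite !inE eqxx (negbTE vw).
  have := E v (mem_head _ _); have := order_point_lt vs'.
  rewrite /= eqxx (negbTE vw) -sz; case: nilP => [s0|_ lt E']; last by rewrite -E' ltxx in lt.
  by move: sz vs'; rewrite s0; case: (s').
subst w; congr (_ :: _).
case/andP: us => vs us; case/andP: us' => vs' us'.
apply: IH => // x.
  have := ss' x; rewrite !inE; have [->|//] := eqVneq x v.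
  by rewrite (negbTE vs) (negbTE vs').
move=> xs; have := E x; rewrite inE xs orbT => /(_ isT) /=.
by have [xv|//] := eqVneq x v; rewrite -xv xs in vs.
Qed.

End OrderPointInj.

Section VertexCounts.
Variables (R : realType) (n : nat) (e : rel 'I_n.+1).
Hypothesis econn : connected_graph e.

Local Notation P := (graph_assoc_set (R := R) e).

Lemma nb_vertices_ge (L : seq (seq 'I_n.+1)) m : uniq L ->
  (forall l, l \in L -> conn_order e l /\ forall v, v \in l) ->
  nb_vertices P m -> (size L <= m)%N.
Proof.
move=> uL HL Pm.
pose pt l : 'rV[R]_n.+1 := \row_v order_point R l v.
rewrite -(size_map pt); apply: (sub_vertices_size Pm).
  rewrite map_inj_in_uniq // => l l' /HL[cl fl] /HL[cl' fl'] /rowP E.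
  apply: (@order_point_inj R); rewrite ?(conn_order_uniq cl) ?(conn_order_uniq cl') //.
    by move=> v; rewrite fl fl'.
  by move=> v _; have := E v; rewrite !mxE.
move=> _ /mapP[l /HL[cl fl] ->]; apply: (conn_order_vertex econn cl fl).
exact/order_point_tight/(conn_order_uniq cl).
Qed.

Lemma nb_vertices_ge_exp2 m : nb_vertices P m -> (2 ^ n <= m)%N.
Proof.
have [esym _ _] := econn.
have [|L [uL <- HL]] := @many_conn_orders _ e esym n finset.setT
  (connected_building econn ord0); first by rewrite cardsT card_ord.
apply: nb_vertices_ge => // l /HL[cl fl]; split=> // v.
by rewrite fl finset.inE.
Qed.

Lemma nb_vertices_complete m : (forall x y, e x y = (x != y)) ->
  nb_vertices P m -> (n.+1`! <= m)%N.
Proof.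
move=> eE; have ue := enum_uniq 'I_n.+1.
have := @nb_vertices_ge (permutations (enum 'I_n.+1)) m (permutations_uniq _).
rewrite size_permutations // size_enum_ord; apply=> l; rewrite mem_permutations => pl.
split=> [|v]; last by rewrite (perm_mem pl) mem_enum.
by apply: conn_order_complete; rewrite // (perm_uniq pl).
Qed.

End VertexCounts.

Lemma nb_vertices_graph1 (R : realType) (e : rel 'I_1) :
  nb_vertices (graph_assoc_set (R := R) e) 1.
Proof.
have PE x : graph_assoc_set e x -> x = const_mx 3 :> 'rV[R]_1.
  move=> [xT _]; apply/rowP => i; rewrite mxE [i]ord1.
  by move: xT; rewrite big_ord1 expr1.
have [x0 Px0] := graph_assoc_nonempty R e.
have x0E := PE x0 Px0; subst x0.
apply: (@nb_vertices_of _ _ _ [:: const_mx 3]) => // [p|u x /PE ->].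
  rewrite inE => /eqP ->; rewrite /vertices /= (_ : [set _] = graph_assoc_set e).
    exact: faces_self.
  by apply/seteqP; split=> [_ -> //|x /PE].
by exists (const_mx 3); rewrite ?inE.
Qed.

Lemma connected_edge2 (e : rel 'I_2) : connected_graph e -> e ord0 ord_max.
Proof.
move=> [_ _ /(_ ord0 ord_max) c].
have [//|//|u [v []]] := connect_exit (A := pred1 ord0) c.
rewrite !inE => /eqP -> v0 uv.
by have <- : v = ord_max by case: v v0 {uv} => -[|[|//]] //= H _; apply/val_inj.
Qed.

Lemma nb_vertices_graph2 (R : realType) (e : rel 'I_2) : connected_graph e ->
  nb_vertices (graph_assoc_set (R := R) e) 2.
Proof.
move=> econn; have [esym _ _] := econn.
have e01 := connected_edge2 econn.
pose pt s : 'rV[R]_2 := \row_v order_point R s v.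
pose i0 : 'I_2 := ord0; pose i1 : 'I_2 := ord_max.
have full : forall v : 'I_2, v \in [:: i1; i0].
  by case=> -[|[|//]] H; rewrite !inE -!val_eqE.
have full' : forall v : 'I_2, v \in [:: i0; i1].
  by move=> v; have := full v; rewrite !inE orbC.
have sum2 (f : 'I_2 -> R) : \sum_i f i = f i0 + f i1.
  by rewrite big_ord_recl big_ord1; congr (_ + f _); apply/val_inj.
apply: (@nb_vertices_of _ _ _ [:: pt [:: i1; i0]; pt [:: i0; i1]]).
- rewrite /= inE andbT; apply/eqP => /rowP/(_ i0); rewrite !mxE /=.
  by rewrite expr1; lra.
- move=> p; rewrite !inE => /orP[] /eqP ->.
    have c : conn_order e [:: i1; i0] by rewrite /= esym e01.
    by apply: (conn_order_vertex econn c full); exact/order_point_tight/(conn_order_uniq c).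
  have c : conn_order e [:: i0; i1] by rewrite /= e01.
  by apply: (conn_order_vertex econn c full'); exact/order_point_tight/(conn_order_uniq c).
- move=> u x [xT xS].
  have x0 : 3 <= x 0 i0.
    have := xS _ (building1 e i0); rewrite finset.cards1 big_set1 expr1; apply.
    by apply/eqP => /finset.setP/(_ i1); rewrite !finset.inE.
  have x1 : 3 <= x 0 i1.
    have := xS _ (building1 e i1); rewrite finset.cards1 big_set1 expr1; apply.
    by apply/eqP => /finset.setP/(_ i0); rewrite !finset.inE.
  rewrite sum2 in xT; rewrite /dotp; under eq_bigr do rewrite -[u _ _ * _]/((fun i => u 0 i * x 0 i) _).
  have [le|/ltW le] := leP (u 0 i0) (u 0 i1).
    exists (pt [:: i1; i0]); first by rewrite !inE eqxx.
    rewrite !sum2 !mxE /= expr1.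
    have : 0 <= (u 0 i1 - u 0 i0) * (x 0 i0 - 3) by rewrite mulr_ge0 ?subr_ge0.
    have -> : x 0 i1 = 9 - x 0 i0 by move: xT; rewrite !exprS expr0; lra.
    lra.
  exists (pt [:: i0; i1]); first by rewrite !inE eqxx orbT.
  rewrite !sum2 !mxE /= expr1.
  have : 0 <= (u 0 i0 - u 0 i1) * (x 0 i1 - 3) by rewrite mulr_ge0 ?subr_ge0.
  have -> : x 0 i0 = 9 - x 0 i1 by move: xT; rewrite !exprS expr0; lra.
  lra.
Qed.

Lemma uniq_full (T : finType) (s : seq T) :
  uniq s -> size s = #|T| -> forall v, v \in s.
Proof.
move=> us sz v; have /subset_cardP H : #|s| = #|T| by rewrite (card_uniqP us).
by rewrite (H (subset_predT _)).
Qed.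

Lemma nb_vertices_path3 (R : realType) (e : rel 'I_3) a b c : connected_graph e ->
  e a b -> e b c -> a != c -> ~~ e a c -> nb_vertices (graph_assoc_set (R := R) e) 5.
Proof.
move=> econn ab bc ac nac; have [cs _] := induced_path3 econn ab bc ac nac.
have us := conn_order_uniq cs.
have full : forall v, v \in [:: c; b; a] by apply: uniq_full; rewrite ?card_ord.
have [_ ] := pentagon_two_face R econn (t := [::]) cs full ab bc nac.
(* With [t] and [D] empty the chain is reduced to the full set, so the face is the whole
   polytope. *)
rewrite /two_face (_ : _ `&` _ = graph_assoc_set e) //.
apply/seteqP; split=> [x []//|x Px]; split=> //= l; rewrite inE => /eqP ->.
by have [xT _] := Px; rewrite (sum_full _ us full) -xT.
Qed.

(** * Relabelling the vertices of a graph *)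

Lemma building_map (T : finType) (e e' : rel T) (f : T -> T) (S : {set T}) :
  symmetric e -> symmetric e' -> injective f ->
  (forall x y, e (f x) (f y) = e' x y) -> building e' S ->
  building e (f @: S)%SET.
Proof.
move=> esym esym' finj fE BS; have /andP[/finset.set0Pn[r rS] _] := BS.
have rS' : {subset [:: r] <= S} by move=> x; rewrite inE => /eqP ->.
have [//|t [ct tE]] := conn_order_extend esym' BS (m := [:: r]) _ isT rS'.
have -> : (f @: S)%SET = [set x in map f (t ++ [:: r])]%SET.
  apply/finset.setP => x; rewrite !finset.inE; apply/imsetP/mapP => -[y yS ->].
    by exists y; rewrite ?tE.
  by exists y; rewrite // -tE.
apply: conn_order_building => //; last by case: (t).
elim: (t ++ _) ct => //= v l IH /and3P[vl vE /IH ->].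
rewrite mem_map // vl andbT /=; case/orP: vE => [/nilP ->//|/hasP[u ul vu]].
by apply/orP; right; apply/hasP; exists (f u); rewrite ?map_f // fE.
Qed.

Lemma comb_ne_col_perm (R : realType) n (s : {perm 'I_n}) (P : set 'rV[R]_n) :
  comb_ne P [set y | P (col_perm s y)].
Proof.
have dE (a x : 'rV[R]_n) : dotp (col_perm s a) (col_perm s x) = dotp a x.
  rewrite /dotp [RHS](reindex_inj (@perm_inj _ s)); apply: eq_bigr => i _.
  by rewrite !mxE.
have K (r : {perm 'I_n}) : cancel (@col_perm R 1 n r) (@col_perm R 1 n r^-1).
  by move=> x; apply/rowP => i; rewrite !mxE permKV.
have K' : cancel (@col_perm R 1 n s^-1) (@col_perm R 1 n s).
  by move=> x; apply/rowP => i; rewrite !mxE permK.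
pose Q := [set y | P (col_perm s y)].
have down F : nfaces P F -> nfaces Q [set y | F (col_perm s y)].
  move=> [[a [c [Pa ->]]] [x [Px ax]]]; split; last first.
    by exists (col_perm s^-1 x); rewrite /= K'.
  have dE' y : dotp (col_perm s^-1 a) y = dotp a (col_perm s y).
    by rewrite -[in RHS](K' a) dE.
  exists (col_perm s^-1 a), c; split=> [y /Pa /=|]; first by rewrite dE'.
  by apply/seteqP; split=> y [Qy /= E]; split=> //=; rewrite ?dE' // -dE'.
have up G : nfaces Q G -> nfaces P [set x | G (col_perm s^-1 x)].
  move=> [[a [c [Qa ->]]] [y [Qy ay]]]; split; last first.
    by exists (col_perm s y); rewrite /= K.
  have dE' x : dotp (col_perm s a) x = dotp a (col_perm s^-1 x).
    by rewrite -[in LHS](K' x) dE.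
  exists (col_perm s a), c; split=> [x Px /=|].
    by rewrite dE'; apply: Qa; rewrite /Q /= K'.
  apply/seteqP; split=> x [/= Hx E].
    by split; [move: Hx; rewrite /Q /= K'|rewrite /= dE'].
  by split; [rewrite /Q /= K'|rewrite -dE'].
exists (fun F => [set y | F (col_perm s y)]), (fun G => [set x | G (col_perm s^-1 x)]).
split=> [F PF|G QG|F F' _ _ FF y|G G' _ _ GG x] /=; [split|split|exact: FF|exact: GG].
- exact: down.
- by apply/seteqP; split=> x /=; rewrite K'.
- exact: up.
- by apply/seteqP; split=> x /=; rewrite K.
Qed.

Lemma graph_assoc_iso (R : realType) n (e e' : rel 'I_n.+1) (s : {perm 'I_n.+1}) :
  symmetric e -> symmetric e' -> (forall x y, e (s x) (s y) = e' x y) ->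
  pgen (graph_assoc R e) = pgen (graph_assoc R e').
Proof.
move=> esym esym' sE; congr (mkmalgU _ _); apply/comb_classP/comb_equivP.
have sub (f f' : rel 'I_n.+1) (r : {perm 'I_n.+1}) x : symmetric f -> symmetric f' ->
    (forall x y, f (r x) (r y) = f' x y) ->
    graph_assoc_set (R := R) f x -> graph_assoc_set (R := R) f' (col_perm r x).
  move=> fsym fsym' rE [xT xS]; split=> [|S BS ST].
    rewrite -xT [RHS](reindex_inj (@perm_inj _ r)); apply: eq_bigr => i _.
    by rewrite mxE.
  have := xS _ (building_map fsym fsym' (@perm_inj _ r) rE BS).
  rewrite card_imset; last exact: perm_inj.
  rewrite big_imset /=; last by move=> ? ? _ _; exact: perm_inj.
  under [in X in _ -> X]eq_bigr do rewrite mxE; apply.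
  apply: contra_neq ST => E; apply/finset.setP => x'; rewrite finset.inE.
  by rewrite -(mem_imset _ _ (@perm_inj _ r)) E finset.inE.
have -> : graph_assoc R e' = [set y | graph_assoc_set e (col_perm s^-1 y)] :> set _.
  apply/seteqP; split=> x /= H.
    by apply: sub H => // i j; rewrite -sE !permKV.
  have -> : x = col_perm s (col_perm s^-1 x).
    by apply/rowP => i; rewrite !mxE permK.
  exact: sub H.
exact: comb_ne_col_perm.
Qed.

(** The graph is a path only up to labelling; listing its vertices along the path gives the
    permutation that carries the standard path to it. *)
Lemma induced_path_associahedron (R : realType) n (e : rel 'I_n.+1) s :
  connected_graph e -> uniq s -> (forall v, v \in s) -> induced_path e s ->
  pgen (graph_assoc R e) = pgen (associahedron R n).
Proof.
move=> econn us sfull sp; have [sym eirr _] := econn.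
have sz : size s = n.+1 := size_full us sfull.
have inj : injective (fun i : 'I_n.+1 => nth ord0 s i).
  by move=> i j /eqP; rewrite nth_uniq ?sz // => /eqP/val_inj.
apply: (@graph_assoc_iso R n _ _ (perm inj)) => // [x y|x y].
  by rewrite /path_graph orbC.
rewrite !permE /path_graph; have [xy|yx|xy] := ltngtP x y.
- rewrite (induced_path_nth ord0 sp) ?sz ?xy ?ltn_ord //.
  by lia.
- rewrite sym (induced_path_nth ord0 sp) ?sz ?yx ?ltn_ord //.
  by lia.
- have -> : x = y by apply/val_inj.
  by rewrite eirr; lia.
Qed.

Lemma small_induced_path n (e : rel 'I_n.+1) : connected_graph e -> (n <= 1)%N ->
  exists s, [/\ uniq s, forall v, v \in s & induced_path e s].
Proof.
move=> econn n1; have [//|t [ct tfull]] := conn_order_full econn (m := [:: ord0]) _ isT.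
exists (t ++ [:: ord0]); have us := conn_order_uniq ct; split=> //.
have := size_full us tfull; case: t ct {us tfull} => [|v [|w t]] //= ct.
  by case/and3P: ct => _; rewrite orbF !andbT => ->.
by rewrite size_cat addnC => -[]; lia.
Qed.

(* [Gamma k] is the graph with k + 1 vertices. *)
Theorem theorem2p3 (R : realType) (Gamma : forall k : nat, rel 'I_k.+1)
    (Gamma_connected : forall k : nat, connected_graph (Gamma k)) :
  let P := fun k : nat => pgen (graph_assoc R (Gamma k)) in
  let A := subring_gen (range P) in
  (forall x : pring R, A x -> A (pder x)) ->
  (forall k : nat, P k = pgen (associahedron R k)) \/
  (forall k : nat, P k = pgen (permutohedron R k)).
Proof.
move=> P A closed.
pose G k := graph_assoc R (Gamma k).
have face (Phi : nat -> Prop) : Phi 1%N ->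
    (forall i j, Phi i -> Phi j -> Phi (i * j)%N) ->
    (forall k m, nb_vertices (G k) m -> Phi m) ->
    forall k F m, nfaces (G k) F -> nb_vertices F m -> Phi m.
  move=> Phi1 PhiM PhiP k F m kF Fm.
  pose F' := Polytope (nface_polytope (polytopeP (G k)) kF).
  have Gk : comb_class (G k) = comb_prod (fun k => comb_class (G k)) [:: k].
    by rewrite /= comb_mulC comb_mul1.
  have [t Ft] := nface_comb_prod closed Gk (G := F') kF.
  exact: (comb_prod_nb_vertices Phi1 PhiM PhiP Ft Fm).
have [noncomplete|complete] := pselect (exists x y, (x != y) && ~~ Gamma 2 x y).
- left; have [a [b [c [ab bc ac nac]]]] :=
    not_complete_induced_path (Gamma_connected 2) noncomplete.
  (* The number 3 is excluded together with 6: since 2 is a number of vertices, avoiding 6 alone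
     would not be stable under products. *)
  have no6 k F m : nfaces (G k) F -> nb_vertices F m -> m <> 3%N /\ m <> 6%N.
    apply: (face (fun m => m <> 3%N /\ m <> 6%N)) => // [i j [i3 i6] [j3 j6]|k' m' km].
      split=> E.
        have le : (i <= 3)%N by apply: dvdn_leq => //; rewrite -E dvdn_mulr.
        by case: i E i3 i6 le => [|[|[|[|]]]] //; lia.
      have le : (i <= 6)%N by apply: dvdn_leq => //; rewrite -E dvdn_mulr.
      by case: i E i3 i6 le => [|[|[|[|[|[|[|]]]]]]] //; lia.
    case: k' km => [|[|[|k']]] km.
    + by rewrite (nb_vertices_inj km (nb_vertices_graph1 R (Gamma 0))).
    + by rewrite (nb_vertices_inj km (nb_vertices_graph2 R (Gamma_connected 1))).
    + by rewrite (nb_vertices_inj km (nb_vertices_path3 R (Gamma_connected 2) ab bc ac nac)).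
    + have := nb_vertices_ge_exp2 (Gamma_connected _) km.
      have : (2 ^ 3 <= 2 ^ k'.+3)%N by rewrite leq_exp2l.
      by lia.
  move=> k; have kconn := Gamma_connected k.
  suff [s [us sfull sp]] : exists s, [/\ uniq s, forall v, v \in s & induced_path (Gamma k) s].
    exact: induced_path_associahedron us sfull sp.
  have [k1|k1] := leqP k 1; first exact: small_induced_path.
  have [k2|k2] := leqP k 2.
    have {k1 k2} E : k = 2 by lia.
    subst k; have [cs ip] := induced_path3 kconn ab bc ac nac.
    have us := conn_order_uniq cs; exists [:: c; b; a]; split=> //.
    by apply: uniq_full; rewrite ?card_ord.
  have [|[D [x [y [z tm]]]]|//] := triangle_minor_or_path kconn; first by rewrite card_ord.
  have cm := triangle_minor_conn_order tm.
  have [//|t [ct tfull]] := conn_order_full kconn cm _.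
  have [nf nv] := hexagon_two_face R kconn tm ct tfull.
  by have [_] := no6 _ _ _ nf nv.
- right.
  (* As 5 is prime, avoiding it is stable under products. *)
  have no5 k F m : nfaces (G k) F -> nb_vertices F m -> m <> 5%N.
    apply: (face (fun m => m <> 5%N)) => // [i j i5 j5 E|k' m' km].
      have i5' : (i <= 5)%N by apply: dvdn_leq => //; rewrite -E dvdn_mulr.
      by case: i E i5 i5' => [|[|[|[|[|[|]]]]]] //; lia.
    case: k' km => [|[|[|k']]] km.
    + by rewrite (nb_vertices_inj km (nb_vertices_graph1 R (Gamma 0))).
    + by rewrite (nb_vertices_inj km (nb_vertices_graph2 R (Gamma_connected 1))).
    + have := nb_vertices_complete (Gamma_connected 2) _ km.
      have eE x y : Gamma 2 x y = (x != y).
        have [_ eirr _] := Gamma_connected 2.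
        have [->|xy] := eqVneq x y; first by rewrite eirr.
        by apply/negPn/negP => nxy; apply: complete; exists x, y; rewrite xy.
      by move=> /(_ eE); rewrite !factS fact0; lia.
    + have := nb_vertices_ge_exp2 (Gamma_connected _) km.
      have : (2 ^ 3 <= 2 ^ k'.+3)%N by rewrite leq_exp2l.
      by lia.
  move=> k; have kconn := Gamma_connected k; have [_ eirr _] := kconn.
  suff -> : P k = pgen (graph_assoc R (@complete_graph k.+1)) by [].
  (* Completeness does not depend on the labelling, so the two relations are shown to be equal. *)
  rewrite /P; congr (pgen (graph_assoc R _)); apply/funext => x; apply/funext => y.
  rewrite /complete_graph; have [->|xy] := eqVneq x y; first by rewrite eirr.
  apply/negPn/negP => nxy.
  have [|a [b [c [ab bc ac nac]]]] := not_complete_induced_path kconn.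
    by exists x, y; rewrite xy.
  have [cm _] := induced_path3 kconn ab bc ac nac.
  have [//|t [ct tfull]] := conn_order_full kconn cm _.
  have [nf nv] := pentagon_two_face R kconn ct tfull ab bc nac.
  exact: no5 nf nv erefl.
Qed.
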